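(* For each positive integer $d$, there are only finitely many totally real number fields $K$ of degree $d=[K:\mathbb{Q}]$ over which there is a ternary (i.e., rank $3$) universal $\mathcal{O}_K$-lattice.
   Context: For a number field $K$, $\mathcal{O}_K$ is its ring of integers; number fields are considered inside a fixed algebraic closure of $\mathbb{Q}$. For a totally real number field $K$, an element $\alpha\in K$ is totally positive ($\alpha\succ 0$) if $\sigma(\alpha)>0$ for every embedding $\sigma:K\hookrightarrow\mathbb{R}$; $\mathcal{O}_K^+$ is the set of totally positive elements of $\mathcal{O}_K$. Let $V$ be an $r$-dimensional quadratic space over $K$ with symmetric bilinear form $B:V\times V\to K$ and quadratic form $Q(v)=B(v,v)$. An $\mathcal{O}_K$-lattice (of rank $r$) is a finitely generated $\mathcal{O}_K$-submodule $L\subset V$ with $KL=V$ (not necessarily free), equipped with the restrictions of $B$ and $Q$; it is always assumed that $Q$ is totally positive definite ($Q(v)\succ 0$ for all nonzero $v\in V$) and that $Q(v)\in\mathcal{O}_K$ for all $v\in L$ (it is not required that $B(v,w)\in\mathcal{O}_K$ for all $v,w\in L$). $L$ is universal if for every $\alpha\in\mathcal{O}_K^+$ there is $v\in L$ with $Q(v)=\alpha$. *)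

(* Defs.v *)
From HB Require Import structures.
From mathcomp Require Import all_boot all_order all_algebra all_field.
From mathcomp Require Import complex.
From mathcomp Require Import boolp classical_sets cardinality reals.

Set Implicit Arguments.
Unset Strict Implicit.
Unset Printing Implicit Defensive.

Import GRing.Theory Num.Theory.

Local Open Scope classical_set_scope.
Local Open Scope ring_scope.

Definition ring_of_integers (K : fieldType) : set K :=
  [set x | integralOver (intr : int -> K) x].

(* [Num.real] in [R[i]] is the set of elements with zero imaginary part. *)
Definition totally_real (R : realType) (K : fieldType) : Prop :=
  forall (sigma : {rmorphism K -> R[i]}) (x : K), sigma x \is Num.real.

Definition totally_positive (R : realType) (K : fieldType) : set K :=
  [set x | forall sigma : {rmorphism K -> R}, 0 < sigma x].

Definition integers_span (K : fieldType) (V : vectType K) (s : seq V) : set V :=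
  [set v | exists2 a : 'I_(size s) -> K,
     (forall i, ring_of_integers (a i)) & v = \sum_i a i *: s`_i].

(* The quadratic form of the space is [fun v => B v v]; the values [B v w] on
   [L] are not required to be integral. *)
Record is_lattice (R : realType) (K : fieldType) (V : vectType K)
    (B : {symmetric V}) (L : set V) : Prop := IsLattice {
  lattice_finitely_generated : exists s : seq V, L = integers_span s ;
  lattice_full : forall v : V,
    exists2 s : seq V, (forall x, x \in s -> L x) & v \in <<s>>%VS ;
  lattice_positive : forall v : V, v != 0 -> totally_positive R (B v v) ;
  lattice_integral : forall v : V, L v -> ring_of_integers (B v v)
}.

Definition universal (R : realType) (K : fieldType) (V : vectType K)
    (B : {symmetric V}) (L : set V) : Prop :=
  forall alpha : K, ring_of_integers alpha -> totally_positive R alpha ->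
    exists2 v : V, L v & B v v = alpha.

Definition has_universal_lattice (R : realType) (K : fieldType) (r : nat) :
    Prop :=
  exists (V : vectType K) (B : {symmetric V}) (L : set V),
    [/\ \dim {:V} = r, is_lattice R B L & universal R B L].

(* Number fields are subfields of the fixed algebraic closure [algC] of the
   rationals, given as images of abstract finite extensions of [rat]; hence
   conjugate but distinct subfields are counted separately. *)
Definition totally_real_with_universal_lattice (R : realType) (d r : nat) :
    set (set algC) :=
  [set F | exists (K : fieldExtType rat) (iota : {rmorphism K -> algC}),
     [/\ F = range iota, \dim {:K} = d, totally_real R K
       & has_universal_lattice R K r]].

(* Main.v *)
From HB Require Import structures.
Require Import Defs.
From mathcomp Require Import all_boot all_order all_algebra all_field.
From mathcomp Require Import complex ring lra zify.
From mathcomp Require finmap.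
From mathcomp Require Import boolp classical_sets cardinality reals.

(** Fix a totally real number field F of degree less than d, and let K run over
    the totally real fields of degree d that contain F.  By Cauchy-Schwarz,
    twice the scalar product of two lattice vectors is an algebraic integer
    whose house, the largest absolute value of its conjugates, is bounded by the
    norms of the vectors.  There are only finitely many algebraic integers of
    bounded degree and house (integral_house_le, finite_bounded_integers).  So
    it is enough to find T, depending on F only, such that every K different
    from F with a universal ternary lattice L contains an integer outside F of
    house at most T: such a K contains one of finitely many fields strictly
    larger than F, and an induction on the degree of F, starting from the
    rationals, proves the theorem (finite_universal_above).

    To find T (universal_ternary_bound), suppose that all integers of K of house
    at most T are in F.  Then vectors of L whose norms are small elements of F
    have scalar products in F.  Suppose that three of them are independent.
    Take alpha to be a totally positive integer outside F of nearly the least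
    possible house X.  A vector v of L of norm alpha has with each of the three
    vectors a scalar product of house of order the square root of X, hence in F.
    So v has coordinates in F, and alpha is in F, a contradiction.

    The three independent vectors exist because the small integers of F cannot
    all be norms in a binary space over F.  A vector of norm 1 and a vector of
    norm c1, for a fixed c1 that is not a square in F, span a binary space that
    represents x^2 + D y^2 with D = c1 - b^2, and b is one of finitely many
    elements of F.  For each totally positive D there is a totally positive
    integer c that is not of the form x^2 + D y^2 (binary_not_universal), and
    the third vector is one of norm c.

    That last fact says that -D is not a square in some completion of F, and is
    proved without class field theory.  Replacing D by a multiple by a square,
    one may assume that D is integral and generates F.  Choose a rational s/t
    whose square separates the largest conjugate of D from the others, with t
    divisible by 2 and by the bad primes, and put a = s^2 - t^2 D.  The norm of
    a over the rationals is negative, and is an odd square modulo 4.  Hence a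
    prime p that is 3 modulo 4 divides it to an odd power (rescale_odd_prime).  Modulo a place of degree
    one above p, t^2 D is the square s^2, so x^2 + D y^2 is, up to squares, the
    anisotropic form x^2 + y^2 there and takes values of even valuation only,
    whereas a has odd valuation (local_obstruction).  Finally c = a (1 + M a)
    has the valuation of a, and is totally positive for large M. *)

Set Implicit Arguments.
Unset Strict Implicit.
Unset Printing Implicit Defensive.

Import Order.TTheory GRing.Theory Num.Theory.

Local Open Scope ring_scope.

(** * Sums of two squares at primes congruent to 3 modulo 4 *)

(** A product of even powers of odd primes and of powers of primes that are 1
    modulo 4 is 1 modulo 4. *)
Lemma prime_3mod4_odd_logn (N : nat) : (N %% 4 = 3)%N ->
  exists p : nat, [/\ prime p, (p %% 4 = 3)%N & odd (logn p N)].
Proof.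
elim/ltn_ind: N => N IH N3.
have N_gt1 : (1 < N)%N by case: N N3 {IH} => [|[]].
pose p := pdiv N; have p_pr : prime p by exact: pdiv_prime.
have N_gt0 : (0 < N)%N by exact: ltnW.
have p_odd : odd p.
  apply: contraLR (pdiv_dvd N) => p_even.
  have -> : pdiv N = 2%N by case: (even_prime p_pr) p_even => [|->].
  by rewrite dvdn2 negbK; lia.
have [/negP|] := boolP (odd (logn p N) && (p %% 4 == 3)%N).
  by move/negP/andP => [? /eqP ?]; exists p.
rewrite negb_and => hp.
pose e := logn p N; have [m pm Nm] := pfactor_coprime p_pr N_gt0.
have e_gt0 : (0 < e)%N by rewrite logn_gt0 mem_primes p_pr N_gt0 pdiv_dvd.
have pe1 : (p ^ e %% 4 = 1)%N.
  have sq1 : (p ^ 2 %% 4 = 1)%N.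
    have [j [->|->]] : exists j, p = (4 * j + 1)%N \/ p = (4 * j + 3)%N.
    - by exists (p %/ 4)%N; lia.
    - by nia.
    - by nia.
  case: (boolP (odd e)) hp => [_ /= p3|e_even _].
    have p1 : (p %% 4 = 1)%N by lia.
    by rewrite -modnXm p1 exp1n.
  by rewrite -(odd_double_half e) (negPf e_even) add0n -mul2n expnM -modnXm sq1 exp1n.
have m3 : (m %% 4 = 3)%N by move: N3; rewrite Nm -modnMmr pe1 muln1.
have m_gt0 : (0 < m)%N by case: m m3 {pm Nm}.
have m_ltN : (m < N)%N.
  rewrite {1}Nm -[X in (X < _)%N]muln1 ltn_pmul2l //.
  by rewrite -(expn0 p) ltn_exp2l ?prime_gt1.
have [q [q_pr q3 q_odd]] := IH m m_ltN m3.
exists q; split=> //.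
have pe_gt0 : (0 < p ^ e)%N by rewrite expn_gt0 prime_gt0.
rewrite Nm lognM // lognX.
have qp : (q != p).
  apply: contraTneq q_odd => ->.
  by rewrite lognE p_pr m_gt0 /= -(negbK (p %| m)%N) -prime_coprime // pm.
by rewrite (logn_prime _ p_pr) (negPf qp) muln0 addn0.
Qed.

(** Fermat's little theorem gives 1 = u^(p-1) = (-1)^((p-1)/2), with (p-1)/2
    odd. *)
Lemma minus_one_nonsquare p (u : 'F_p) : prime p -> (p %% 4 = 3)%N -> u ^+ 2 != -1.
Proof.
move=> p_pr p3; apply/eqP => u2.
have p_gt0 := prime_gt0 p_pr.
have u_neq0 : u != 0.
  by apply: contra_eq_neq u2 => ->; rewrite expr0n /= eq_sym oppr_eq0 oner_neq0.
have : u ^+ (p.-1) = 1.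
  have up : u ^+ p = u by have := expf_card u; rewrite card_Fp.
  by apply: (mulfI u_neq0); rewrite -exprS prednK // up mulr1.
have -> : p.-1 = (2 * (p %/ 4).*2.+1)%N by lia.
rewrite exprM u2 exprS -mul2n exprM sqrrN expr1n expr1n mulr1 => /eqP.
rewrite eq_sym -subr_eq0 opprK (_ : 1 + 1 = 2%:R) //.
rewrite -(dvdn_pcharf (pchar_Fp p_pr)) => p2.
have {p2} := dvdn_leq (isT : (0 < 2)%N) p2.
by move: p3; case: p p_pr {u u2 u_neq0 p_gt0} => [|[|[|]]].
Qed.

(** Since b is a nonzero square modulo p and -1 is not a square, the form
    X^2 + b Y^2 is anisotropic modulo p. *)
Lemma dvdz_sum_sqr p (s b X Y : int) : prime p -> (p %% 4 = 3)%N ->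
    ~~ (p%:Z %| s)%Z -> (p%:Z %| b - s ^+ 2)%Z -> (p%:Z %| X ^+ 2 + b * Y ^+ 2)%Z ->
  (p%:Z %| X)%Z /\ (p%:Z %| Y)%Z.
Proof.
move=> p_pr p3 ps pb pXY.
pose f (z : int) : 'F_p := z%:~R.
have fE z : (p%:Z %| z)%Z = (f z == 0) by rewrite (dvdz_pcharf (pchar_Fp p_pr)).
rewrite !fE in ps pb pXY *.
move: ps pb pXY; rewrite /f rmorphB rmorphD rmorphM !rmorphXn /=.
set x := X%:~R; set y := Y%:~R; set u := s%:~R; set v := b%:~R => u0.
rewrite subr_eq0 => /eqP ->.
have [-> |y0] := eqVneq y 0; first by rewrite expr0n /= mulr0 addr0 expf_eq0.
rewrite addr_eq0 => /eqP xy; exfalso.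
have /eqP[] := @minus_one_nonsquare p (x / (u * y)) p_pr p3.
by rewrite exprMn xy exprVn exprMn mulNr divff // mulf_neq0 ?expf_neq0.
Qed.

(** Descent: anisotropy modulo p allows X and Y to be divided by p, so that the
    valuation of a value of the form is even. *)
Lemma sum_sqr_even_val p (s b : int) : prime p -> (p %% 4 = 3)%N ->
    ~~ (p%:Z %| s)%Z -> (p%:Z %| b - s ^+ 2)%Z ->
  forall (i : nat) (X Y : int), (p%:Z ^+ i.*2.+1 %| X ^+ 2 + b * Y ^+ 2)%Z ->
  (p%:Z ^+ i.*2.+2 %| X ^+ 2 + b * Y ^+ 2)%Z.
Proof.
move=> p_pr p3 ps pb; have p0 : p%:Z != 0 by rewrite -lt0n prime_gt0.
elim=> [|i IH] X Y pXY.
  have [] := dvdz_sum_sqr p_pr p3 ps pb pXY => /dvdzP[x ->] /dvdzP[y ->].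
  by apply/dvdzP; exists (x ^+ 2 + b * y ^+ 2); ring.
have : (p%:Z %| X ^+ 2 + b * Y ^+ 2)%Z.
  by apply: dvdz_trans pXY; rewrite exprS dvdz_mulr.
move=> /(dvdz_sum_sqr p_pr p3 ps pb) [] /dvdzP[x xE] /dvdzP[y yE].
move: pXY; rewrite xE yE.
have -> : (x * p%:Z) ^+ 2 + b * (y * p%:Z) ^+ 2
  = (x ^+ 2 + b * y ^+ 2) * p%:Z ^+ 2 by ring.
have expSS k : p%:Z ^+ k.+2 = p%:Z ^+ k * p%:Z ^+ 2 by rewrite -exprD addn2.
rewrite doubleS (expSS i.*2.+1) (expSS i.*2.+2) !dvdz_mul2r ?expf_neq0 //.
exact: IH.
Qed.

(** * Approximate integer roots and a local obstruction *)

Lemma horner_addr (A : comNzRingType) (h : {poly A}) (x d : A) :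
  exists e, h.[x + d] = h.[x] + d * h^`().[x] + d ^+ 2 * e.
Proof.
elim/poly_ind: h => [|h c [e IH]].
  by exists 0; rewrite derivC !horner0; ring.
exists (h^`().[x] + (x + d) * e).
by rewrite derivMXaddC !hornerE IH; ring.
Qed.

Lemma dvdz_hornerB (h : {poly int}) (x y : int) : (x - y %| h.[x] - h.[y])%Z.
Proof.
have [e] := horner_addr h y (x - y); rewrite (addrC y) subrK => ->.
by apply/dvdzP; exists (h^`().[y] + (x - y) * e); ring.
Qed.

Lemma Euclid_dvdz p (x y : int) : prime p ->
  (p%:Z %| x * y)%Z = (p%:Z %| x)%Z || (p%:Z %| y)%Z.
Proof. by move=> p_pr; rewrite !dvdzE abszM /= Euclid_dvdM. Qed.

(** Newton's method: as h'(r1) is invertible modulo p, a multiple of p^(k+1)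
    added to r1 cancels h(r1) modulo p^(k+2). *)
Lemma Hensel_simple_root p (h : {poly int}) (r : int) : prime p ->
    (p%:Z %| h.[r])%Z -> ~~ (p%:Z %| h^`().[r])%Z ->
  forall k : nat, exists r' : int, (p%:Z %| r' - r)%Z /\ (p%:Z ^+ k %| h.[r'])%Z.
Proof.
move=> p_pr hr h'r; elim=> [|k [r1 [r1r hr1]]].
  by exists r; rewrite subrr dvdz0 expr0 dvd1z.
case: k hr1 => [_|k hr1]; first by exists r; rewrite subrr dvdz0 expr1.
have h'r1 : ~~ (p%:Z %| h^`().[r1])%Z.
  apply: contra h'r => ph; rewrite -(subrK h^`().[r1] h^`().[r]) rpredD //.
  by apply: dvdz_trans (dvdz_hornerB _ _ _); rewrite -opprB rpredN.
have /coprimezP [[u v] /= uv] : coprimez h^`().[r1] p%:Z.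
  by rewrite coprimez_sym coprimezE prime_coprime.
have /dvdzP [c cE] := hr1.
pose d := - (u * c) * p%:Z ^+ k.+1.
exists (r1 + d); split.
  by rewrite addrAC rpredD // /d exprS mulrA (mulrC _ p%:Z) -mulrA dvdz_mulr.
have [e ->] := horner_addr h r1 d.
apply/dvdzP; exists (c * v + (u * c) ^+ 2 * p%:Z ^+ k * e).
rewrite cE /d; have -> : h^`().[r1] = h^`().[r1] by [].
transitivity (c * p%:Z ^+ k.+1 * (1 - u * h^`().[r1]) +
  (u * c) ^+ 2 * p%:Z ^+ k.+1 * p%:Z ^+ k.+1 * e); first by ring.
by rewrite -uv !exprS; ring.
Qed.

Definition exact_val (p k : nat) (a : int) :=
  exists2 a', a = a' * p%:Z ^+ k & ~~ (p%:Z %| a')%Z.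

Lemma exact_valM p k l a b : prime p ->
  exact_val p k a -> exact_val p l b -> exact_val p (k + l) (a * b).
Proof.
move=> p_pr [a' -> pa] [b' -> pb]; exists (a' * b'); first by rewrite exprD; ring.
by rewrite Euclid_dvdz // negb_or pa.
Qed.

Lemma exact_val0 p a : ~~ (p%:Z %| a)%Z -> exact_val p 0 a.
Proof. by exists a; rewrite ?mulr1. Qed.

Lemma exact_val_exists p a : prime p -> a != 0 ->
  exact_val p (logn p `|a|) a.
Proof.
move=> p_pr a0; have a_gt0 : (0 < `|a|)%N by rewrite absz_gt0.
have [m pm am] := pfactor_coprime p_pr a_gt0.
exists (sgz a * m%:Z).
  have pX k : Posz (p ^ k) = p%:Z ^+ k by rewrite -[LHS]natz natrX natz.
  by rewrite {1}[a]intEsg {1}am PoszM -mulrA pX.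
rewrite dvdzE abszM (_ : `|sgz a|%N = 1%N) ?mul1n; last by case: sgzP a0.
by rewrite -prime_coprime.
Qed.

Lemma exact_val_notdvd p k a : prime p -> exact_val p k a ->
  ~~ (p%:Z ^+ k.+1 %| a)%Z.
Proof.
move=> p_pr [a' -> pa]; rewrite exprS dvdz_mul2r //.
by rewrite expf_neq0 // -lt0n prime_gt0.
Qed.

Lemma exact_val_Gauss p k l m a : prime p -> exact_val p l m ->
  (p%:Z ^+ (k + l) %| m * a)%Z -> (p%:Z ^+ k %| a)%Z.
Proof.
move=> p_pr [m' -> pm]; rewrite exprD mulrAC dvdz_mul2r.
  by rewrite Gauss_dvdzr // coprimezE abszX coprimeXl // prime_coprime.
by rewrite expf_neq0 // -lt0n prime_gt0.
Qed.

(** For r congruent to s^2 modulo p and a root of g modulo a high power of p,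
    evaluation at r approximates the embedding of Q[X]/(g) into the p-adic
    numbers given by the simple root s^2 of g modulo p.  Under it s^2 - X has
    the odd valuation e, whereas x^2 + X y^2 has even valuation, because X is
    the square s^2 modulo p.  The integers z and m clear denominators. *)
Lemma local_obstruction p (g x y : {poly int}) (s M z m : int) (e : nat) :
    prime p -> (p %% 4 = 3)%N -> odd e -> ~~ (p%:Z %| s)%Z ->
    exact_val p e g.[s ^+ 2] -> ~~ (p%:Z %| g^`().[s ^+ 2])%Z ->
    z != 0 -> m != 0 ->
  ~ (forall r : int, (g.[r] %| m * (z ^+ 2 * ((s ^+ 2 - r) * (1 + M * (s ^+ 2 - r)))
       - (x.[r] ^+ 2 + r * y.[r] ^+ 2)))%Z).
Proof.
move=> p_pr p3 e_odd ps ge g's z0 m0 rel.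
have p0 : p%:Z != 0 by rewrite -lt0n prime_gt0.
have zv := exact_val_exists p_pr z0; set a := logn _ _ in zv.
have mv := exact_val_exists p_pr m0; set l := logn _ _ in mv.
have e_gt0 : (0 < e)%N by case: e e_odd {ge}.
have pgs : (p%:Z %| g.[s ^+ 2])%Z.
  by case: ge => c -> _; rewrite dvdz_mull // dvdz_exp.
(* 2i+1 is the valuation of z^2 (s^2 - r); the root r has to be known to a
   precision that exceeds it by 1 after the division by m. *)
pose i := (a + e./2)%N.
have vE : (a + a + e = i.*2.+1)%N by rewrite /i; lia.
have le_e : (e.+1 <= i.*2.+2 + l)%N by lia.
have [r [rs gr]] := Hensel_simple_root p_pr pgs g's (i.*2.+2 + l).
have dv : exact_val p e (s ^+ 2 - r).
  have [E] := horner_addr g r (s ^+ 2 - r); rewrite (addrC r) subrK => gE.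
  have pd : (p%:Z %| s ^+ 2 - r)%Z by rewrite -opprB rpredN.
  set u := g^`().[r] + (s ^+ 2 - r) * E.
  have pu : ~~ (p%:Z %| u)%Z.
    apply: contra g's => pu.
    rewrite -(subrK g^`().[r] g^`().[s ^+ 2]) rpredD //.
      exact: dvdz_trans (dvdz_hornerB _ _ _).
    rewrite -(addrK ((s ^+ 2 - r) * E) g^`().[r]) rpredB //.
    by rewrite dvdz_mulr.
  have ud : g.[s ^+ 2] = g.[r] + u * (s ^+ 2 - r) by rewrite gE /u; ring.
  clearbody u.
  have grN n : (n <= i.*2.+2 + l)%N -> (p%:Z ^+ n %| g.[r])%Z.
    by move=> ?; apply: dvdz_trans gr; exact: dvdz_exp2l.
  have : (p%:Z ^+ (e + 0) %| u * (s ^+ 2 - r))%Z.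
    have -> : u * (s ^+ 2 - r) = g.[s ^+ 2] - g.[r].
      by rewrite ud addrAC subrr add0r.
    rewrite addn0 rpredB //; last exact/grN/ltnW.
    by case: ge => c -> _; rewrite dvdz_mull.
  move=> /(exact_val_Gauss p_pr (exact_val0 pu)) /dvdzP[c cE].
  exists c => //; apply/negP => /dvdzP[c' c'E].
  have /negP[] := exact_val_notdvd p_pr ge.
  rewrite ud rpredD //; first exact: grN.
  by rewrite cE c'E; apply/dvdzP; exists (u * c'); rewrite exprS; ring.
have qv : exact_val p 0 (1 + M * (s ^+ 2 - r)).
  apply: exact_val0; apply/negP => p1; have : (p%:Z %| 1%R)%Z.
    rewrite -[1%R in X in (_ %| X)%Z](addrK (M * (s ^+ 2 - r))) rpredB // dvdz_mull //.
    by rewrite -opprB rpredN.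
  by rewrite dvdz1 /= => /eqP p1'; rewrite p1' in p_pr.
set A := z ^+ 2 * ((s ^+ 2 - r) * (1 + M * (s ^+ 2 - r))).
have Av : exact_val p i.*2.+1 A.
  rewrite -vE /A expr2 -(addn0 e).
  by apply: exact_valM (exact_valM p_pr zv zv) (exact_valM p_pr dv qv).
have pm : (p%:Z ^+ i.*2.+2 %| A - (x.[r] ^+ 2 + r * y.[r] ^+ 2))%Z.
  by apply: (exact_val_Gauss p_pr mv); apply: dvdz_trans (rel r).
have p1 : (p%:Z ^+ i.*2.+1 %| x.[r] ^+ 2 + r * y.[r] ^+ 2)%Z.
  rewrite -[X in (_ %| X)%Z](subKr A) rpredB //.
    by case: Av => c -> _; rewrite dvdz_mull.
  by apply: dvdz_trans pm; apply: dvdz_exp2l.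
have {p1} p2 := sum_sqr_even_val p_pr p3 ps rs p1.
have /negP[] := exact_val_notdvd p_pr Av.
by rewrite -[A](subrK (x.[r] ^+ 2 + r * y.[r] ^+ 2)) rpredD.
Qed.

(** * Rescaled polynomials and a global choice of prime *)

(** For monic h, the monic polynomial whose roots are those of h multiplied by
    c. *)
Definition rescale (A : nzRingType) (c : A) (h : {poly A}) :=
  \poly_(i < size h) (h`_i * c ^+ ((size h).-1 - i)).

Lemma horner_rescale (A : comNzRingType) (c : A) (h : {poly A}) x :
  (rescale c h).[c * x] = c ^+ (size h).-1 * h.[x].
Proof.
rewrite horner_poly horner_coef mulr_sumr; apply: eq_bigr => i _.
have hi : (i <= (size h).-1)%N by case: (size h) i => [[]|n i] //=; rewrite -ltnS.
rewrite exprMn -[in RHS](subnK hi) exprD; ring.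
Qed.

Lemma map_rescale (A B : nzRingType) (f : {rmorphism A -> B}) (c : A) (h : {poly A}) :
  injective f -> map_poly f (rescale c h) = rescale (f c) (map_poly f h).
Proof.
move=> f_inj; have sz : size (map_poly f h) = size h by rewrite size_map_inj_poly ?rmorph0.
apply/polyP => i; rewrite coef_map /rescale !coef_poly sz. case: ifP => _.
  by rewrite [LHS](rmorphM f) (rmorphXn f).
exact: (rmorph0 f).
Qed.

Lemma rescale_comp (A : comNzRingType) (c : A) (h : {poly A}) :
  rescale c h \Po (c *: 'X) = c ^+ (size h).-1 *: h.
Proof.
have := horner_rescale c%:P (h^:P) 'X.
rewrite -(@map_rescale A {poly A} polyC c h (@polyC_inj A)).
rewrite -[(map_poly _ (rescale c h)).[_]]/(_ \Po _) -[h^:P.['X]]/(h \Po 'X) comp_polyXr.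
by rewrite size_map_polyC -polyC_exp !mul_polyC.
Qed.

Lemma deriv_rescale (A : comNzRingType) (c : A) (h : {poly A}) x :
  c * (rescale c h)^`().[c * x] = c ^+ (size h).-1 * h^`().[x].
Proof.
have := rescale_comp c h.
move=> /(congr1 (fun q => q^`().[x])).
rewrite deriv_comp !derivZ derivX hornerM horner_comp !hornerZ hornerX hornerC.
by rewrite mulr1 mulrC.
Qed.

Lemma rescale_mod (c a : int) (h : {poly int}) : h \is monic ->
  (c %| (rescale c h).[a] - a ^+ (size h).-1)%Z.
Proof.
move=> h_mon; have h0 : (0 < size h)%N by rewrite size_poly_gt0 monic_neq0.
have hn : h`_(size h).-1 = 1 by exact/monicP.
rewrite horner_poly; move: hn; rewrite -(prednK h0) /= => hn.
rewrite big_ord_recr /= subnn expr0 mulr1 hn mul1r addrK.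
apply: rpred_sum => i _; rewrite dvdz_mulr // dvdz_mull // dvdz_exp //.
by rewrite subn_gt0.
Qed.

(** The value at s^2 of the rescaled polynomial is negative, and congruent to
    the odd square s^(2n) modulo 4 because t is even: its absolute value is 3
    modulo 4.  A prime p that divides it cannot divide t, since it would divide
    s as well; so p divides neither the Bezout constant R0, which makes s^2 a
    simple root modulo p, nor h(0), which keeps p from dividing s. *)
Lemma rescale_odd_prime (h u w : {poly int}) (R0 s t : int) : h \is monic ->
    u * h + w * h^`() = R0%:P -> coprimez s t -> (2 %| t)%Z ->
    (forall p, prime p -> (p%:Z %| R0 * h.[0])%Z -> (p%:Z %| t)%Z) ->
    (rescale (t ^+ 2) h).[s ^+ 2] < 0 ->
  exists p e, [/\ prime p, (p %% 4 = 3)%N, odd e, ~~ (p%:Z %| s)%Z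
    & exact_val p e (rescale (t ^+ 2) h).[s ^+ 2] /\
      ~~ (p%:Z %| (rescale (t ^+ 2) h)^`().[s ^+ 2])%Z].
Proof.
move=> h_mon bez st t2 pt; set g := rescale _ _ => gneg.
have gmod : (t ^+ 2 %| g.[s ^+ 2] - (s ^+ 2) ^+ (size h).-1)%Z by exact: rescale_mod.
have ndvd_st p : prime p -> (p%:Z %| s)%Z -> (p%:Z %| t)%Z -> False.
  move=> p_pr ps ptt; have : (p%:Z %| gcdz s t)%Z by rewrite dvdz_gcd ps.
  by rewrite (eqP st) dvdz1 /= => /eqP p1; rewrite p1 in p_pr.
have N3 : (`|g.[s ^+ 2]| %% 4 = 3)%N.
  have /dvdzP[a aE] : (4 %| g.[s ^+ 2] - (s ^+ 2) ^+ (size h).-1)%Z.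
    by apply: dvdz_trans gmod; apply: (@dvdz_exp2r 2 t 2).
  have /dvdzP[b bE] : (4 %| (s ^+ 2) ^+ (size h).-1 - 1)%Z.
    have s_odd : (s %% 2)%Z = 1.
      have : ~~ (2 %| s)%Z by apply/negP => /(@ndvd_st 2 isT); apply.
      by rewrite dvdzE /=; lia.
    have s4 : (4 %| s ^+ 2 - 1)%Z.
      apply/dvdzP; exists ((s %/ 2)%Z * ((s %/ 2)%Z + 1)).
      by rewrite {1}(divz_eq s 2) s_odd; ring.
    apply: dvdz_trans s4 _; rewrite subrX1; exact: dvdz_mulr.
  by lia.
have [p [p_pr p3 e_odd]] := prime_3mod4_odd_logn N3.
have g0 : g.[s ^+ 2] != 0 by rewrite lt_eqF.
have gv := exact_val_exists p_pr g0.
have pg : (p%:Z %| g.[s ^+ 2])%Z.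
  by case: gv => c -> _; rewrite dvdz_mull // dvdz_exp //; case: logn e_odd.
have p_t : ~~ (p%:Z %| t)%Z.
  apply/negP => p_t; apply: (ndvd_st p p_pr) => //.
  have : (p%:Z %| (s ^+ 2) ^+ (size h).-1)%Z.
    rewrite -[X in (_ %| X)%Z](subKr g.[s ^+ 2]) rpredB //.
    by apply: dvdz_trans gmod; rewrite dvdz_exp.
  by rewrite -exprM !dvdzE abszX /= Euclid_dvdX // => /andP[].
have pX x n : (p%:Z %| t ^+ n * x)%Z = (p%:Z %| x)%Z.
  rewrite Euclid_dvdz // [X in X || _](_ : _ = false) //.
  apply: contraNF p_t; rewrite !dvdzE abszX /= Euclid_dvdX //.
  by case/andP.
have /coprimezP [[a b] /= ab] : coprimez (t ^+ 2) p%:Z.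
  by rewrite coprimez_sym coprimezE abszX prime_coprime // Euclid_dvdX // andbT.
(* r is (s/t)^2 modulo p, which brings the problem back to h. *)
pose r := a * s ^+ 2.
have rs : (p%:Z %| t ^+ 2 * r - s ^+ 2)%Z.
  apply/dvdzP; exists (- b * s ^+ 2); rewrite /r.
  transitivity ((a * t ^+ 2 + b * p%:Z - 1) * s ^+ 2 - b * s ^+ 2 * p%:Z); first by ring.
  by rewrite ab; ring.
have gcong (q : {poly int}) : (p%:Z %| q.[t ^+ 2 * r])%Z = (p%:Z %| q.[s ^+ 2])%Z.
  have D := dvdz_trans rs (dvdz_hornerB q _ _).
  by rewrite -[in LHS](subrK q.[s ^+ 2] q.[t ^+ 2 * r]) rpredDl.
have phr : (p%:Z %| h.[r])%Z.
  by have := pg; rewrite -gcong horner_rescale -exprM pX.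
exists p, (logn p `|g.[s ^+ 2]|); split => //; last first.
  split=> //; apply/negP; rewrite -gcong -(pX _ 2) deriv_rescale -exprM pX => ph'.
  apply/negP: p_t; rewrite negbK; apply: pt => //; rewrite dvdz_mulr //.
  have := congr1 (fun q => q.[r]) bez; rewrite hornerD !hornerM hornerC => <-.
  by rewrite rpredD // dvdz_mull.
apply/negP => ps; apply: (ndvd_st p p_pr) => //; apply: pt => //; rewrite dvdz_mull //.
have := gcong h; have : (p%:Z %| r)%Z by rewrite /r expr2 mulrA dvdz_mull.
move=> pr _; rewrite -[X in (_ %| X)%Z](subKr h.[r]) rpredB //.
by have := dvdz_hornerB h r 0; rewrite subr0; apply: dvdz_trans.
Qed.

(** * Complex embeddings of number fields *)

Section RationalPolynomials.
Variable K : fieldExtType rat.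
Implicit Types (x : K) (p q : {poly rat}).

Lemma rat_minPoly x : exists q, [/\ q \is monic, size q = (\dim <<1; x>>).+1,
  separable_poly q & forall p, root (map_poly (in_alg K) p) x = (q %| p)].
Proof.
have /polyOver1P[q qE] := minPolyOver 1%AS x.
have q_mon : q \is monic by rewrite -(map_monic (in_alg K)) -qE monic_minPoly.
exists q; split => // [||p].
  rewrite -(size_map_poly (in_alg K)) -qE size_minPoly adjoin_degreeE.
  by rewrite dimv1 divn1.
  rewrite -(separable_map (in_alg K)) -qE; apply: pcharf0_separable => i.
  by rewrite (pchar_lalg K) pchar_num.
apply/idP/idP => [px|/dvdpP[r ->]]; last first.
  by rewrite rmorphM /= rootM -qE root_minPoly orbT.
rewrite -(dvdp_map (in_alg K)) -qE minPoly_dvdp //.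
by apply/polyOver1P; exists p.
Qed.

Lemma primitive_generator : exists k : K, <<1; k>>%VS = fullv.
Proof.
exists (separable_generator 1 {:K}); rewrite -eq_adjoin_separable_generator ?sub1v //.
apply/separableP => u _; apply: pcharf0_separable => i.
by rewrite (pchar_lalg K) pchar_num.
Qed.

Lemma primitive_horner k x : <<1; k>>%VS = fullv ->
  exists p, x = (map_poly (in_alg K) p).[k].
Proof. by move=> kgen; apply/Fadjoin1_polyP; rewrite kgen memvf. Qed.

Lemma rmorph_horner_alg (A : numFieldType) (f : {rmorphism K -> A}) p x :
  f (map_poly (in_alg K) p).[x] = (map_poly ratr p).[f x].
Proof.
rewrite -horner_map -map_poly_comp; congr _.[_]; apply: eq_map_poly => a /=.
by rewrite alg_num_field fmorph_rat.
Qed.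

Lemma rmorph_root_alg (A : numFieldType) (f : {rmorphism K -> A}) p x :
  root (map_poly (in_alg K) p) x = root (map_poly ratr p) (f x).
Proof. by rewrite /root -rmorph_horner_alg fmorph_eq0. Qed.

(** The field K is Q[X]/(q), so mapping k to z is well defined. *)
Lemma rmorph_extend_root (A : numFieldType) k q (z : A) :
    <<1; k>>%VS = fullv ->
    (forall p, root (map_poly (in_alg K) p) k = (q %| p)) ->
  root (map_poly ratr q) z -> exists f : {rmorphism K -> A}, f k = z.
Proof.
move=> kgen qmin qz.
have rep x : exists p, x == (map_poly (in_alg K) p).[k].
  by have [p ->] := primitive_horner x kgen; exists p.
pose g x := xchoose (rep x).
have gE x : (map_poly (in_alg K) (g x)).[k] = x by rewrite -(eqP (xchooseP (rep x))).
pose f x := (map_poly ratr (g x)).[z] : A.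
have fE p x : (map_poly (in_alg K) p).[k] = x -> f x = (map_poly ratr p).[z].
  move=> pk; apply/eqP; rewrite /f -subr_eq0 -hornerN -hornerD -rmorphB.
  have /dvdpP[r ->] : q %| g x - p.
    by rewrite -qmin /root rmorphB hornerD hornerN gE pk subrr.
  by rewrite rmorphM hornerM (rootP qz) mulr0.
have fB : zmod_morphism f.
  move=> x y; rewrite (fE (g x - g y)) rmorphB hornerD hornerN //.
  by rewrite !gE.
have fM : monoid_morphism f.
  split=> [|x y]; first by rewrite (fE 1) rmorph1 hornerC.
  by rewrite (fE (g x * g y)) rmorphM hornerM // !gE.
pose aM := GRing.isZmodMorphism.Build _ _ f fB.
pose mM := GRing.isMonoidMorphism.Build _ _ f fM.
pose F : {rmorphism K -> A} := HB.pack f aM mM.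
by exists F; rewrite /= (fE 'X) map_polyX hornerX.
Qed.

End RationalPolynomials.

Lemma horner_mx_eigen (F : fieldType) n (A : 'M[F]_n.+1) (a : F) (v : 'rV_n.+1) p :
  v *m A = a *: v -> v *m horner_mx A p = p.[a] *: v.
Proof.
move=> vA; elim/poly_ind: p => [|p c IH]; first by rewrite rmorph0 mulmx0 horner0 scale0r.
rewrite rmorphD rmorphM /= horner_mx_X horner_mx_C mulmxDr mulmxA IH -scalemxAl vA.
by rewrite mul_mx_scalar !hornerE scalerA scalerDl.
Qed.

(** x = g(k) is an eigenvalue of g(A), for A the companion matrix of k; so all
    conjugates of x are eigenvalues of g(A), and these are the values of g at
    the eigenvalues of A, the conjugates of k. *)
Lemma conjugate_rmorph (K : fieldExtType rat) (C : numClosedFieldType) (x : K)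
    (q : {poly rat}) (z : C) :
    (forall p, root (map_poly (in_alg K) p) x = (q %| p)) ->
  root (map_poly ratr q) z -> exists f : {rmorphism K -> C}, f x = z.
Proof.
move=> qmin qz; have [k kgen] := primitive_generator K.
have [h [h_mon h_sz _ hmin]] := rat_minPoly k.
have [g gx] := primitive_horner x kgen.
have [n [A hA]] : exists n (A : 'M[rat]_n.+1), char_poly A = h.
  have := companionmxK h_mon; move: (companionmx h).
  rewrite h_sz kgen /=; have : (0 < \dim {:K})%N by exact: adim_gt0.
  by case: (\dim _) => // n _ A; exists n, A.
pose M := horner_mx A g.
have qM : q %| char_poly M.
  rewrite -qmin map_char_poly -eigenvalue_root_char.
  have : eigenvalue (map_mx (in_alg K) A) k.
    by rewrite eigenvalue_root_char -map_char_poly hA hmin.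
  move=> /eigenvalueP[v vA v0]; apply/eigenvalueP; exists v => //.
  by rewrite map_horner_mx (horner_mx_eigen _ vA) gx.
have : root (map_poly ratr (char_poly M)) z.
  by have /dvdpP[r ->] := qM; rewrite rmorphM rootM qz orbT.
rewrite map_char_poly -eigenvalue_root_char => /eigenvalueP[v vM v0].
pose P := map_poly ratr g - z%:P : {poly C}.
have vP : v *m horner_mx (map_mx ratr A) P = 0.
  rewrite rmorphB /= horner_mx_C mulmxBr -map_horner_mx vM mul_mx_scalar.
  by rewrite subrr.
have : ~~ coprimep P (map_poly ratr h).
  apply: contra v0 => /Bezout_eq1_coprimepP[[a b] /= ab].
  have h0 := Cayley_Hamilton (map_mx (@ratr C) A).
  rewrite -map_char_poly hA in h0.
  have := congr1 (horner_mx (map_mx ratr A)) ab.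
  rewrite rmorphD !rmorphM /= h0 mulr0 addr0 -rmorphM mulrC rmorphM rmorph1 /= => aP.
  by rewrite -[v]mulmx1 -[1%:M]aP mulmxA vP mul0mx.
move=> /Pdiv.ClosedField.coprimepP Pn.
have [w Pw hw] : exists2 w, root P w & root (map_poly ratr h) w.
  apply: contrapT => nw; apply: Pn => w Pw; apply/negP => hw; apply: nw.
  by exists w.
have [f fk] := rmorph_extend_root kgen hmin hw; exists f.
rewrite gx rmorph_horner_alg fk; apply/eqP.
by move: Pw; rewrite /root hornerD hornerN hornerC subr_eq0.
Qed.

(** * Totally real fields and their integers *)

Lemma real_rmorph (R : realType) (K : fieldType) (f : {rmorphism K -> R[i]}) :
    (forall x, f x \is Num.real) ->
  exists g : {rmorphism K -> R}, forall x, (g x)%:C%C = f x.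
Proof.
move=> f_real; pose g x := complex.Re (f x).
have gE x : (g x)%:C%C = f x by rewrite /g RRe_real.
have gB : zmod_morphism g.
  by move=> x y; apply: (@complexI R); rewrite gE !rmorphB /= !gE.
have gM : monoid_morphism g.
  split=> [|x y]; apply: (@complexI R); rewrite gE ?rmorph1 //.
  by rewrite !rmorphM /= !gE.
pose aM := GRing.isZmodMorphism.Build _ _ g gB.
pose mM := GRing.isMonoidMorphism.Build _ _ g gM.
by exists (HB.pack g aM mM : {rmorphism K -> R}).
Qed.

(** The house of x, the largest absolute value of a conjugate, is at most T. *)
Definition house_le (R : realType) (K : fieldType) (x : K) (T : R) :=
  forall f : {rmorphism K -> R}, `|f x| <= T.

Section TotallyReal.
Variables (R : realType) (K : fieldExtType rat).
Hypothesis K_real : totally_real R K.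

(** A real root of the minimal polynomial is the image of x under an embedding
    into the complex numbers, and such an embedding has real values. *)
Lemma real_conjugate (x : K) (q : {poly rat}) (z : R) :
    (forall p, root (map_poly (in_alg K) p) x = (q %| p)) ->
  root (map_poly ratr q) z -> exists f : {rmorphism K -> R}, f x = z.
Proof.
move=> qmin qz.
have [|f fx] := @conjugate_rmorph K R[i] x q z%:C%C qmin.
  have : root (map_poly (real_complex R) (map_poly ratr q)) z%:C%C.
    by rewrite fmorph_root.
  by rewrite -map_poly_comp (eq_map_poly (fmorph_rat _)).
have [g gE] := real_rmorph (K_real f).
by exists g; apply: (@complexI R); rewrite gE.
Qed.

Lemma real_splitting (x : K) (q : {poly rat}) : q \is monic ->
    (forall p, root (map_poly (in_alg K) p) x = (q %| p)) ->
  exists2 rs : seq R, map_poly ratr q = \prod_(z <- rs) ('X - z%:P)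
    & forall z, z \in rs -> exists f : {rmorphism K -> R}, f x = z.
Proof.
move=> q_mon qmin.
have [zs zsE] := closed_field_poly_normal (map_poly (@ratr R[i]) q).
rewrite (monicP _) ?map_monic // scale1r in zsE.
have zs_real z : z \in zs -> z \is Num.real.
  move=> zzs; have [|f <-] := @conjugate_rmorph K R[i] x q z qmin; last exact: K_real.
  by rewrite zsE root_prod_XsubC.
pose rs := map (@complex.Re R) zs.
have rsE : map_poly (@ratr R) q = \prod_(z <- rs) ('X - z%:P).
  apply: (map_inj_poly (@complexI R)) => //.
  rewrite -map_poly_comp (eq_map_poly (fmorph_rat _)) zsE rmorph_prod big_map.
  rewrite [LHS]big_seq [RHS]big_seq; apply: eq_bigr => z zzs.
  by rewrite rmorphB /= map_polyX map_polyC /= RRe_real ?zs_real.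
exists rs => // z zrs; apply: (real_conjugate qmin).
by rewrite rsE root_prod_XsubC.
Qed.

Lemma house_le_exists (x : K) : exists T : nat, house_le x (T%:R : R).
Proof.
have [q [q_mon _ _ qmin]] := rat_minPoly x.
have [rs rsE _] := real_splitting q_mon qmin.
have [T TP] : exists T : nat, forall z, z \in rs -> `|z| <= T%:R :> R.
  elim: rs {rsE} => [|z rs [T TP]]; first by exists 0%N.
  exists (T + Num.bound `|z|)%N => y; rewrite inE natrD => /predU1P[->|/TP yT].
    by rewrite (le_trans (ltW (archi_boundP (normr_ge0 z)))) // lerDr ler0n.
  by rewrite (le_trans yT) // lerDl ler0n.
exists T => f; apply: TP; rewrite -root_prod_XsubC -rsE.
by rewrite -rmorph_root_alg qmin dvdpp.
Qed.

End TotallyReal.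

Section Subfields.
Variables (R : realType) (F K : fieldExtType rat) (j : {rmorphism F -> K}).

Lemma root_alg_subfield (p : {poly rat}) (x : F) :
  root (map_poly (in_alg K) p) (j x) = root (map_poly (in_alg F) p) x.
Proof.
rewrite -(fmorph_root j) -map_poly_comp; congr root; apply: eq_map_poly => a /=.
by rewrite !alg_num_field fmorph_rat.
Qed.

Lemma totally_real_subfield : totally_real R K -> totally_real R F.
Proof.
move=> K_real f x; have [q [_ _ _ qmin]] := rat_minPoly x.
have [p||g <-] := @conjugate_rmorph K R[i] (j x) q (f x).
- by rewrite root_alg_subfield qmin.
- by rewrite -rmorph_root_alg qmin dvdpp.
- exact: K_real.
Qed.

Lemma real_conjugate_subfield (x : F) (f : {rmorphism F -> R}) :
  totally_real R K -> exists g : {rmorphism K -> R}, g (j x) = f x.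
Proof.
move=> K_real; have [q [_ _ _ qmin]] := rat_minPoly x.
apply: (@real_conjugate _ _ K_real _ q) => [p|]; first by rewrite root_alg_subfield.
by rewrite -rmorph_root_alg qmin dvdpp.
Qed.

Lemma totally_positive_ext (x : F) : totally_positive R x -> totally_positive R (j x).
Proof. by move=> x_pos f; apply: (x_pos (f \o j)). Qed.

Lemma totally_positive_subfield (x : F) : totally_real R K ->
  totally_positive R (j x) -> totally_positive R x.
Proof.
by move=> K_real x_pos f; have [g <-] := real_conjugate_subfield x f K_real.
Qed.

Lemma house_le_ext (x : F) (T : R) : house_le x T -> house_le (j x) T.
Proof. by move=> xT f; apply: (xT (f \o j)). Qed.

Lemma house_le_subfield (x : F) (T : R) : totally_real R K ->
  house_le (j x) T -> house_le x T.
Proof.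
by move=> K_real xT f; have [g <-] := real_conjugate_subfield x f K_real.
Qed.

End Subfields.

Section Integers.
Variables (L K : fieldType) (j : {rmorphism L -> K}).

Lemma integral_ext (x : L) : ring_of_integers x -> ring_of_integers (j x).
Proof.
case=> p p_mon px; exists p => //.
rewrite -(eq_map_poly (rmorph_int j)) map_poly_comp fmorph_root //.
Qed.

Lemma integral_subfield (x : L) : ring_of_integers (j x) -> ring_of_integers x.
Proof.
case=> p p_mon px; exists p => //.
by rewrite -(fmorph_root j) -map_poly_comp (eq_map_poly (rmorph_int j)).
Qed.

Lemma integralD (x y : L) :
  ring_of_integers x -> ring_of_integers y -> ring_of_integers (x + y).
Proof. exact: (@integral_add _ _ (intr : {rmorphism int -> L})). Qed.

Lemma integralM (x y : L) :
  ring_of_integers x -> ring_of_integers y -> ring_of_integers (x * y).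
Proof. exact: (@integral_mul _ _ (intr : {rmorphism int -> L})). Qed.

Lemma integralN (x : L) : ring_of_integers x -> ring_of_integers (- x).
Proof. exact: (@integral_opp _ _ (intr : {rmorphism int -> L})). Qed.

Lemma integral_intr (m : int) : ring_of_integers (m%:~R : L).
Proof. exact: (@integral_id _ _ (intr : {rmorphism int -> L})). Qed.

End Integers.

(** By Gauss's lemma, a monic rational factor of a monic integer polynomial has
    integer coefficients. *)
Lemma integral_minPoly (K : fieldExtType rat) (x : K) (q : {poly rat}) :
    ring_of_integers x -> q \is monic ->
    (forall p, root (map_poly (in_alg K) p) x = (q %| p)) ->
  exists2 h : {poly int}, h \is monic & map_poly intr h = q.
Proof.
move=> [p p_mon px] q_mon qmin.
have : q %| map_poly intr p.
  rewrite -qmin -map_poly_comp; congr (root _ x): px; apply: eq_map_poly => m /=.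
  by rewrite alg_num_field ratr_int.
case/dvdpP_rat_int => h [a a0 qE] [r pE].
have := congr1 lead_coef pE; rewrite (monicP p_mon) lead_coefM => hr.
have h1 : lead_coef h = 1 \/ lead_coef h = -1.
  have : (lead_coef h %| 1%R)%Z by rewrite hr dvdz_mulr.
  by rewrite dvdz1; lia.
have q1 : q = (lead_coef h)%:~R *: map_poly intr h.
  have := monicP q_mon; rewrite {1}qE lead_coefZ lead_coef_map_inj //; last exact: intr_inj.
  rewrite qE => ah; congr (_ *: _); case: h1 ah => ->; first by rewrite mulr1.
  by rewrite rmorphN1 mulrN1 => <-; rewrite opprK.
exists (lead_coef h *: h); last by rewrite map_polyZ.
by rewrite monicE lead_coefZ; case: h1 => ->.
Qed.

(** * Totally positive binary forms are not universal *)

Lemma nat_nonroot (A : numDomainType) (P : {poly A}) : P != 0 ->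
  exists m : nat, P.[m%:R] != 0.
Proof.
move=> P0; apply: contrapT => nP.
have Proots : all (root P) [seq m%:R | m <- iota 0 (size P)].
  apply/allP => _ /mapP[m _ ->]; apply/negPn/negP => Pm; apply: nP.
  by exists m.
have := max_poly_roots P0 Proots.
rewrite size_map size_iota ltnn map_inj_uniq ?iota_uniq; first by move=> /(_ isT).
by move=> a b /eqP; rewrite eqr_nat => /eqP.
Qed.

Lemma clear_denominators (r : {poly rat}) :
  exists b (r' : {poly int}), b != 0 /\ b%:~R *: r = map_poly intr r'.
Proof.
have [r' [a a0 ->]] := rat_poly_scale r; exists a, r'; split=> //.
by rewrite scalerA divff ?scale1r // intr_eq0.
Qed.

(** If a clears the denominators of the minimal polynomial q of x, then a x is a
    root of q rescaled by a, which has integer coefficients. *)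
Lemma integral_multiple (K : fieldExtType rat) (x : K) :
  exists2 a : int, a != 0 & ring_of_integers (a%:~R * x).
Proof.
have [q [q_mon q_sz _ qmin]] := rat_minPoly x.
have [a [h [a0 hE]]] := clear_denominators q; exists a => //.
pose n := (size q).-1; have szq : size q = n.+1 by rewrite /n q_sz.
pose p := 'X^n + \poly_(i < n) (h`_i * a ^+ (n.-1 - i)).
have pE : map_poly intr p = rescale (a%:~R : rat) q.
  apply/polyP => i; rewrite coef_map coef_poly coefD coefXn coef_poly szq /= ltnS.
  have hi : (h`_i)%:~R = a%:~R * q`_i by rewrite -coefZ hE coef_map.
  have [->|ni] := eqVneq i n.
    rewrite ltnn leqnn subnn expr0 mulr1 addr0 /n -/(lead_coef q) (monicP q_mon).
    by [].
  rewrite (leq_eqVlt i) (negPf ni) /= add0r; case: ltnP => // lt_in.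
  rewrite rmorphM rmorphXn /= hi mulrAC -exprS mulrC; congr (_ * _ ^+ _).
  lia.
exists p.
  by rewrite monicE lead_coefDl ?lead_coefXn // size_polyXn ltnS size_poly.
have -> : map_poly intr p = map_poly (in_alg K) (map_poly intr p).
  by rewrite -map_poly_comp; apply: eq_map_poly => m /=; rewrite alg_num_field ratr_int.
rewrite pE map_rescale; last exact: fmorph_inj.
rewrite /root rmorph_int horner_rescale mulf_eq0; apply/orP; right.
by have := qmin q; rewrite dvdpp.
Qed.

(** An element with pairwise distinct conjugates generates F.  For a generator k
    of F and two embeddings, the conjugates of D (k + m)^2 coincide for at most
    finitely many m, because a nonzero polynomial in m vanishes then: its value
    at minus a conjugate of k is nonzero, as D is totally positive. *)
Lemma square_multiple_generator (R : realType) (F : fieldExtType rat) (D : F) :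
    totally_real R F -> totally_positive R D ->
  exists y : F, [/\ y != 0, ring_of_integers (D * y ^+ 2) &
    <<1; D * y ^+ 2>>%VS = fullv].
Proof.
move=> F_real D_pos; have [k kgen] := primitive_generator F.
have [q [q_mon q_sz q_sep qmin]] := rat_minPoly k.
have [rs rsE rsP] := real_splitting F_real q_mon qmin.
have rs_uniq : uniq rs.
  by rewrite -separable_prod_XsubC -rsE separable_map.
have rs_sz : size rs = \dim {:F}.
  have := congr1 (fun p : {poly R} => size p) rsE.
  by rewrite /= size_map_poly size_prod_XsubC q_sz kgen => -[].
have rs0 : exists z, z \in rs.
  have : (0 < size rs)%N by rewrite rs_sz adim_gt0.
  by case: (rs) => // z ? _; exists z; rewrite inE eqxx.
have [z0 /rsP[f0 _]] := rs0.
have /choice[f fP] : forall z, exists f : {rmorphism F -> R}, z \in rs -> f k = z.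
  by move=> z; case: (boolP (z \in rs)) => [/rsP[g]|_]; [exists g | exists f0].
pose P z z' : {poly R} :=
  (f z D)%:P * (z%:P + 'X) ^+ 2 - (f z' D)%:P * (z'%:P + 'X) ^+ 2.
have PE z z' x : (P z z').[x] = f z D * (z + x) ^+ 2 - f z' D * (z' + x) ^+ 2.
  by rewrite hornerD hornerN !hornerM !hornerC !hornerD !hornerC !hornerX -!expr2.
have P0 z z' : z' != z -> P z z' != 0.
  move=> zz'; apply/eqP => /(congr1 (fun p : {poly R} => p.[- z])).
  rewrite PE horner0 addrN expr0n /= mulr0 sub0r => /eqP.
  rewrite oppr_eq0 mulf_eq0 expf_eq0 /= subr_eq0 (negPf zz') orbF.
  by rewrite gt_eqF // D_pos.
pose Pi := (\prod_(z <- rs) ('X + z%:P)) *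
  \prod_(z <- rs) \prod_(z' <- rs | z' != z) P z z'.
have Pi0 : Pi != 0.
  rewrite mulf_neq0 // prodf_seq_neq0; apply/allP => z _ /=.
    by rewrite -size_poly_eq0 size_XaddC.
  by rewrite prodf_seq_neq0; apply/allP => z' _; apply/implyP => /P0.
have [m] := nat_nonroot Pi0.
rewrite hornerM mulf_eq0 negb_or !horner_prod !prodf_seq_neq0.
move=> /andP[/allP m0 /allP mP].
have y0_neq0 : k + m%:R != 0.
  apply/eqP => km; have [z zrs] := rs0; have := m0 z zrs; rewrite /= hornerD hornerX hornerC.
  by rewrite -(fP z zrs) addrC -(rmorph_nat (f z)) -rmorphD km rmorph0 eqxx.
have [a a0 a_int] := integral_multiple (D * (k + m%:R) ^+ 2).
exists (a%:~R * (k + m%:R)).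
have a0F : a%:~R != 0 :> F.
  by rewrite -(ratr_int F) -alg_num_field scaler_eq0 oner_eq0 orbF intr_eq0.
set E := D * _; have EE : E = a%:~R ^+ 2 * (D * (k + m%:R) ^+ 2).
  by rewrite /E exprMn mulrCA.
split.
- by rewrite mulf_neq0.
- rewrite EE expr2 -mulrA; apply: integralM => //; exact: integral_intr.
have [qE [qE_mon qE_sz _ qEmin]] := rat_minPoly E.
apply/eqP; rewrite eqEdim subvf /= -rs_sz -ltnS -qE_sz.
have fEE z : f z E = a%:~R ^+ 2 * (f z D * (f z k + m%:R) ^+ 2).
  by rewrite EE rmorphM rmorphXn rmorphM rmorphXn rmorphD rmorph_int rmorph_nat.
have fE_uniq : uniq [seq f z E | z <- rs].
  rewrite map_inj_in_uniq // => z z' zrs zrs' fzE; apply/eqP; rewrite eq_sym.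
  apply: contraTT isT => zz'; have := mP z zrs.
  rewrite /= horner_prod prodf_seq_neq0 => /allP/(_ z' zrs').
  rewrite zz' /= PE => /negP[].
  move: fzE; rewrite !fEE !fP //.
  move=> /mulfI-> //; first by rewrite subrr.
  by rewrite expf_eq0 intr_eq0.
rewrite -(size_map (fun z => f z E)) -(size_map_poly (@ratr R)).
apply: max_poly_roots => //; first by rewrite map_poly_eq0 monic_neq0.
by apply/allP => _ /mapP[z _ ->]; rewrite -rmorph_root_alg qEmin dvdpp.
Qed.

(** The fractions (1 + 2Uj) / (2U)^n are in lowest terms and dense among the
    positive reals, so one of their squares lies between the largest element of
    rs and the others. *)
Lemma separating_square (R : realType) (rs : seq R) (U : nat) :
    rs != [::] -> (forall z, z \in rs -> 0 < z) -> (0 < U)%N ->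
  exists (s t : nat) (d : R), [/\ coprime s t, (2 * U %| t)%N, (0 < t)%N, d \in rs &
    s%:R ^+ 2 < t%:R ^+ 2 * d /\
    forall z, z \in rs -> z != d -> t%:R ^+ 2 * z < s%:R ^+ 2].
Proof.
move=> rs0 rs_pos U_gt0.
have [d [l [drs l0 ld lmax]]] : exists d l, [/\ d \in rs, 0 <= l, l < d &
    forall z, z \in rs -> z != d -> z <= l].
  elim: rs rs0 rs_pos => // x rs IH _ rs_pos.
  have x0 : 0 < x by apply: rs_pos; rewrite inE eqxx.
  have [rsE|rs0] := eqVneq rs [::].
    exists x, 0; rewrite rsE inE eqxx; split=> // z; rewrite inE => /eqP->.
    by rewrite eqxx.
  have [z zrs|d [l [drs l0 ld lmax]]] := IH rs0; first by rewrite rs_pos // inE zrs orbT.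
  have [xd|dx|xd] := ltgtP x d.
  - exists d, (Num.max l x); rewrite inE drs orbT le_max l0 gt_max ld xd.
    split=> // z; rewrite inE le_max => /predU1P[->|/lmax zl /zl ->] //.
    by rewrite lexx orbT.
  - exists x, d; rewrite inE eqxx; split=> // [|z].
      exact: le_trans l0 (ltW ld).
    rewrite inE => /predU1P[->|/lmax zl _]; first by rewrite eqxx.
    by have [->//|/zl zl'] := eqVneq z d; exact: le_trans zl' (ltW ld).
  - exists d, l; rewrite inE drs orbT; split=> // z.
    by rewrite inE xd => /predU1P[->|/lmax]; rewrite ?eqxx.
pose g := Num.sqrt d; pose h := Num.sqrt l.
have d0 : 0 < d by exact: rs_pos.
have hg : h < g by rewrite ltr_sqrt.
have h0 : 0 <= h by exact: sqrtr_ge0.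
pose B := (2 * U)%N; have B_gt1 : (1 < B)%N by rewrite /B; lia.
have BR0 : 0 < B%:R :> R by rewrite ltr0n; lia.
(* A denominator for which the interval from h t to g t is longer than 2B. *)
pose a := Num.bound (2 * B%:R / (g - h)); pose t := (B ^ a.+1)%N.
have t_gt0 : (0 < t)%N by rewrite expn_gt0; lia.
have ta : 2 * B%:R < t%:R * (g - h).
  rewrite -ltr_pdivrMr ?subr_gt0 //.
  apply: lt_trans (archi_boundP _) _.
    by rewrite divr_ge0 ?mulr_ge0 ?ler0n // subr_ge0 ltW.
  rewrite ltr_nat; apply: ltn_trans (ltn_expl _ B_gt1) _.
  by rewrite ltn_exp2l.
pose y := h * t%:R / B%:R.
have y0 : 0 <= y by rewrite divr_ge0 ?mulr_ge0 ?ler0n.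
pose j := (Num.truncn y).+1; pose s := (1 + B * j)%N.
have /andP[jl ju] := truncn_itv y0.
have sE : s%:R = 1 + B%:R * j%:R :> R by rewrite natrD natrM.
have yB : B%:R * y = h * t%:R by rewrite /y mulrC divfK // gt_eqF.
have sl : h * t%:R < s%:R.
  by rewrite sE -yB ltr_wpDl // ltr_pM2l.
have su : s%:R < g * t%:R.
  have jy : j%:R <= y + 1 by rewrite -natr1 lerD2r.
  have : s%:R <= 1 + B%:R * (y + 1) by rewrite sE lerD2l ler_pM2l.
  rewrite mulrDr yB mulr1 => sy.
  have B1 : 1 < B%:R :> R by rewrite ltr1n.
  have := ta; rewrite mulrBr (mulrC _ g) (mulrC _ h); lra.
exists s, t, d; split=> //.
- rewrite /t coprimeXr // /s coprime_sym /coprime.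
  by rewrite addnC mulnC gcdnMDl gcdn1.
- by rewrite /t expnS dvdn_mulr.
have tsqr x : 0 <= x -> t%:R ^+ 2 * x = (Num.sqrt x * t%:R) ^+ 2.
  by move=> x0; rewrite exprMn sqr_sqrtr // mulrC.
split; first by rewrite tsqr ?ltW // ltr_sqr // nnegrE ?mulr_ge0 ?sqrtr_ge0 ?ler0n.
move=> z zrs /(lmax _ zrs) zl; apply: (@le_lt_trans _ _ (t%:R ^+ 2 * l)).
  by rewrite ler_wpM2l ?exprn_ge0 ?ler0n.
by rewrite tsqr // ltr_sqr // nnegrE ?mulr_ge0 ?sqrtr_ge0 ?ler0n.
Qed.

Lemma nat_bound_seq (R : realType) (rs : seq R) (a : R -> R) :
  exists M : nat, forall z, z \in rs -> a z < M%:R.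
Proof.
elim: rs => [|x rs [M MP]]; first by exists 0%N.
exists (M + Num.bound `|a x|)%N => z; rewrite inE natrD => /predU1P[->|/MP zM].
  rewrite (le_lt_trans (ler_norm _)) // (lt_le_trans (archi_boundP (normr_ge0 _))) //.
  by rewrite lerDr ler0n.
by rewrite (lt_le_trans zM) // lerDl ler0n.
Qed.

Lemma map_intr_inj (A : numDomainType) : injective (map_poly (intr : int -> A)).
Proof. by apply: map_inj_poly => //; exact: intr_inj. Qed.

Lemma separable_Bezout_int (h : {poly int}) : separable_poly (map_poly intr h : {poly rat}) ->
  exists (u w : {poly int}) (c : int), c != 0 /\ u * h + w * h^`() = c%:P.
Proof.
rewrite unlock => /Bezout_eq1_coprimepP[[u w] /= uw].
have [b [u' [b0 bu]]] := clear_denominators u.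
have [c [w' [c0 cw]]] := clear_denominators w.
exists (c *: u'), (b *: w'), (b * c); split; first by rewrite mulf_neq0.
apply: (@map_intr_inj rat).
rewrite rmorphD !rmorphM /= !map_polyZ /= map_polyC /= -bu -cw -deriv_map.
rewrite !map_polyC /= -[RHS]mulr1 -uw -!mul_polyC -!/(map_poly intr h); ring.
Qed.

Lemma dvdp_int_multiple (g A : {poly int}) :
    (map_poly intr g : {poly rat}) %| map_poly intr A ->
  exists m : int, m != 0 /\ forall r, (g.[r] %| m * A.[r])%Z.
Proof.
case/dvdpP => r rE; have [m [r' [m0 mr]]] := clear_denominators r.
exists m; split=> // x.
have <- : (r' * g).[x] = m * A.[x].
  rewrite -hornerZ; congr _.[_]; apply: (@map_intr_inj rat).
  by rewrite rmorphM /= -mr map_polyZ /= rE scalerAl.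
by rewrite hornerM dvdz_mull.
Qed.

Lemma map_poly_intr_alg (K : fieldExtType rat) (h : {poly int}) :
  map_poly (in_alg K) (map_poly intr h) = map_poly intr h.
Proof.
by rewrite -map_poly_comp; apply: eq_map_poly => m /=; rewrite alg_num_field ratr_int.
Qed.

Lemma generator_int_horner (K : fieldExtType rat) (E x : K) (t : int) :
    <<1; E>>%VS = fullv -> t != 0 ->
  exists (b : int) (P : {poly int}), b != 0 /\
    b%:~R * x = (map_poly intr P).[t%:~R * E].
Proof.
move=> Egen t0; have [P ->] := primitive_horner x Egen.
have [b [P' [b0 bP]]] := clear_denominators (P \Po (t%:~R^-1 *: 'X)).
exists b, P'; split=> //.
rewrite -map_poly_intr_alg -bP map_polyZ hornerZ rmorph_int.
congr (_ * _); rewrite map_comp_poly horner_comp map_polyZ hornerZ map_polyX hornerX.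
rewrite fmorphV rmorph_int mulKf // -(rmorph_int (in_alg K)) fmorph_eq0.
by rewrite intr_eq0.
Qed.

(** The obstruction to c = x^2 + t^2 E y^2 is at the prime p given by
    rescale_odd_prime: t^2 E is congruent to s^2 at a place of degree one above
    p, at which c = a (1 + M a), for a = s^2 - t^2 E, has odd valuation.  The
    factor 1 + M a is a unit there, and makes c totally positive although one
    conjugate of a is negative. *)
Lemma generator_not_universal (R : realType) (F : fieldExtType rat) (E : F) :
    totally_real R F -> totally_positive R E -> ring_of_integers E ->
    <<1; E>>%VS = fullv ->
  exists (c : F) (t : int), [/\ ring_of_integers c, totally_positive R c, t != 0
    & forall x y, c != x ^+ 2 + t%:~R ^+ 2 * E * y ^+ 2].
Proof.
move=> F_real E_pos E_int Egen.
have [q [q_mon q_sz q_sep qmin]] := rat_minPoly E.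
have [rs rsE rsP] := real_splitting F_real q_mon qmin.
have [h h_mon hq] := integral_minPoly E_int q_mon qmin.
have hR : map_poly intr h = \prod_(z <- rs) ('X - z%:P).
  rewrite -rsE -hq -map_poly_comp; apply: eq_map_poly => m /=.
  by rewrite ratr_int.
have rs_uniq : uniq rs by rewrite -separable_prod_XsubC -rsE separable_map.
have rs_pos z : z \in rs -> 0 < z by move=> /rsP[f <-]; exact: E_pos.
have rs0 : rs != [::].
  have := congr1 (fun p : {poly R} => size p) rsE.
  rewrite /= size_map_poly size_prod_XsubC q_sz Egen -size_eq0 => -[<-].
  by rewrite -lt0n adim_gt0.
have ErsP (f : {rmorphism F -> R}) : f E \in rs.
  by rewrite -root_prod_XsubC -rsE -rmorph_root_alg qmin dvdpp.
have [u [w [r0 [r00 bez]]]] : exists u w c, c != 0 /\ u * h + w * h^`() = c%:P.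
  by apply: separable_Bezout_int; rewrite hq.
have h0 : h.[0] != 0.
  rewrite -(intr_eq0 R) -(rmorph0 (intr : int -> R)) -horner_map /= hR horner_prod.
  rewrite prodf_seq_neq0; apply/allP => z zrs /=.
  by rewrite hornerD hornerN hornerX hornerC sub0r oppr_eq0 gt_eqF ?rs_pos.
have U_gt0 : (0 < absz (r0 * h.[0])%R)%N by rewrite absz_gt0 mulf_neq0.
have [s [t [d [st Ut t_gt0 drs [sd sz]]]]] := separating_square rs0 rs_pos U_gt0.
have tR0 : t%:R != 0 :> R by rewrite pnatr_eq0 -lt0n.
pose g := rescale (t%:Z ^+ 2) h.
have gs_neg : g.[s%:Z ^+ 2] < 0.
  rewrite -(ltrz0 R) -horner_map map_rescale; last exact: intr_inj.
  rewrite !rmorphXn /= -!pmulrn hR.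
  rewrite -[s%:R ^+ 2](@divfK _ (t%:R ^+ 2)) ?expf_neq0 // mulrC horner_rescale.
  rewrite pmulr_rlt0 ?exprn_gt0 ?ltr0n // horner_prod (bigD1_seq d) //=.
  rewrite nmulr_rlt0 ?hornerXsubC; last first.
    by rewrite subr_lt0 ltr_pdivrMr ?exprn_gt0 ?ltr0n // mulrC.
  rewrite big_seq_cond prodr_gt0 // => z /andP[zrs zd].
  by rewrite hornerXsubC subr_gt0 ltr_pdivlMr ?exprn_gt0 ?ltr0n // mulrC sz.
have [p [e [p_pr p3 e_odd ps [ge g's]]]] :
    exists p e, [/\ prime p, (p %% 4 = 3)%N, odd e, ~~ (p%:Z %| s%:Z)%Z
    & exact_val p e g.[s%:Z ^+ 2] /\ ~~ (p%:Z %| g^`().[s%:Z ^+ 2])%Z].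
  apply: (rescale_odd_prime h_mon bez) => //.
    by rewrite dvdzE; apply: dvdn_trans Ut; exact: dvdn_mulr.
  move=> p _; rewrite !dvdzE /= => pU; apply: dvdn_trans Ut.
  by rewrite dvdn_mull.
(* At a real place where a is negative, this M gives 1 + M a < 0. *)
have [M MP] := nat_bound_seq rs (fun z => `|s%:R ^+ 2 - t%:R ^+ 2 * z|^-1).
pose a : F := s%:R ^+ 2 - t%:R ^+ 2 * E.
exists (a * (1 + M%:R * a)), t%:Z.
have natint n : ring_of_integers (n%:R : F) by exact: (integral_intr F n).
have a_int : ring_of_integers a.
  rewrite /a !expr2; apply: integralD; first exact: integralM.
  by apply: integralN; apply: integralM => //; exact: integralM.
split.
- apply: integralM => //; apply: integralD; first exact: (integral_intr F 1).
  exact: integralM.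
- move=> f; set b := f a; have -> : f (a * (1 + M%:R * a)) = b * (1 + M%:R * b).
    by rewrite rmorphM (rmorphD f 1) rmorph1 (rmorphM f M%:R) rmorph_nat.
  have bE : b = s%:R ^+ 2 - t%:R ^+ 2 * f E.
    by rewrite /b /a rmorphB (rmorphM f (_ ^+ _)) !rmorphXn !rmorph_nat.
  have [b0|b0] := ltP 0 b.
    by rewrite mulr_gt0 // ltr_wpDr // mulr_ge0 ?ler0n // ltW.
  have b_lt0 : b < 0.
    rewrite lt_neqAle b0 andbT bE; have [->|fd] := eqVneq (f E) d.
      by rewrite lt_eqF // subr_lt0.
    by rewrite gt_eqF // subr_gt0 sz.
  have := MP _ (ErsP f); rewrite -bE ltr0_norm // => Mb.
  rewrite nmulr_rgt0 // -ltrBrDl sub0r.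
  have : 1 < M%:R * - b by rewrite -ltr_pdivrMr ?oppr_gt0 // div1r.
  by rewrite mulrN ltrNr.
- by rewrite -lt0n.
move=> x y; apply/eqP => cE.
have t2 : t%:Z ^+ 2 != 0 by rewrite expf_neq0 // -lt0n.
have [b1 [P1 [b10 xE]]] := generator_int_horner x Egen t2.
have [b2 [P2 [b20 yE]]] := generator_int_horner y Egen t2.
(* With denominators cleared, the relation says that A vanishes at t^2 E, whose
   minimal polynomial is g. *)
pose z := b1 * b2; pose X1 := b2 *: P1; pose Y1 := b1 *: P2.
pose A : {poly int} := (z ^+ 2)%:P * (((s%:Z ^+ 2)%:P - 'X) *
  (1 + M%:Z%:P * ((s%:Z ^+ 2)%:P - 'X))) - (X1 ^+ 2 + 'X * Y1 ^+ 2).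
have AE r : A.[r] = z ^+ 2 * ((s%:Z ^+ 2 - r) * (1 + M%:Z * (s%:Z ^+ 2 - r)))
    - (X1.[r] ^+ 2 + r * Y1.[r] ^+ 2).
  by rewrite /A !(hornerD, hornerN, hornerM, horner_exp, hornerC, hornerX).
have AK : root (map_poly intr A) ((t%:Z ^+ 2)%:~R * E).
  set T : F := _ * E; pose ev (P : {poly int}) : F := (map_poly intr P).[T].
  have evD P Q : ev (P + Q) = ev P + ev Q by rewrite /ev rmorphD hornerD.
  have evN P : ev (- P) = - ev P by rewrite /ev rmorphN hornerN.
  have evM P Q : ev (P * Q) = ev P * ev Q by rewrite /ev rmorphM hornerM.
  have evC (n : int) : ev n%:P = n%:~R by rewrite /ev map_polyC hornerC.
  have evX : ev 'X = T by rewrite /ev map_polyX hornerX.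
  have X1E : ev X1 = z%:~R * x.
    by rewrite /ev map_polyZ hornerZ /= -xE intrM mulrA (mulrC b2%:~R).
  have Y1E : ev Y1 = z%:~R * y.
    by rewrite /ev map_polyZ hornerZ /= -yE intrM mulrA.
  have aE : ev ((s%:Z ^+ 2)%:P - 'X) = a.
    by rewrite evD evN evC evX /a /T !rmorphXn /= -!pmulrn.
  rewrite /root -/(ev A) /A evD evN evD !expr2 !evM evC aE (evD 1) evM aE.
  rewrite (evC 1) (evC M%:Z) X1E Y1E evX -pmulrn mulr1z cE /T !expr2 !intrM.
  by apply/eqP; ring.
have gA : (map_poly intr g : {poly rat}) %| map_poly intr A.
  pose tau : {poly rat} := (t%:Z ^+ 2)%:~R *: 'X.
  pose tau' : {poly rat} := (t%:Z ^+ 2)%:~R^-1 *: 'X.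
  have tt' : tau \Po tau' = 'X.
    by rewrite comp_polyZ comp_polyX scalerA divff ?scale1r ?intr_eq0.
  rewrite -[map_poly intr g]comp_polyXr -[map_poly intr A]comp_polyXr -tt' !comp_polyA.
  apply: dvdp_comp_poly; rewrite map_rescale; last exact: intr_inj.
  rewrite rescale_comp hq dvdpZl ?expf_neq0 ?intr_eq0 // -qmin map_comp_poly.
  rewrite /root horner_comp map_polyZ hornerZ map_polyX hornerX rmorph_int.
  by rewrite map_poly_intr_alg.
have [m [m0 gmA]] := dvdp_int_multiple gA.
apply: (@local_obstruction p g X1 Y1 s%:Z M%:Z z m e) => //.
  by rewrite mulf_neq0.
by move=> r; rewrite -AE.
Qed.

(** The forms x^2 + D y^2 and x^2 + D w^2 y^2 have the same values, so D may be
    replaced by an integral generator of F in its square class. *)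
Lemma binary_not_universal (R : realType) (F : fieldExtType rat) (D : F) :
    totally_real R F -> totally_positive R D ->
  exists c : F, [/\ ring_of_integers c, totally_positive R c
    & forall x y, c != x ^+ 2 + D * y ^+ 2].
Proof.
move=> F_real D_pos.
have [w [w0 E_int Egen]] := square_multiple_generator F_real D_pos.
have E_pos : totally_positive R (D * w ^+ 2).
  move=> f; rewrite rmorphM rmorphXn pmulr_rgt0; last exact: D_pos.
  by rewrite exprn_even_gt0 // fmorph_eq0.
have [c [t [c_int c_pos t0 cP]]] := generator_not_universal F_real E_pos E_int Egen.
exists c; split=> // x y; apply: contraNneq (cP x (y / (t%:~R * w))) => ->; apply/eqP.
have tF0 : t%:~R != 0 :> F.
  by rewrite -(ratr_int F) -alg_num_field scaler_eq0 oner_eq0 orbF intr_eq0.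
by field; rewrite tF0 w0.
Qed.

(** * Integers of bounded house *)

Lemma coef_prod_XsubC_le (R : realDomainType) (T : R) (rs : seq R) (i : nat) :
    0 <= T -> (forall z, z \in rs -> `|z| <= T) ->
  `|(\prod_(z <- rs) ('X - z%:P))`_i| <= (1 + T) ^+ size rs.
Proof.
move=> T0; elim: rs i => [|z rs IH] i rsT.
  by rewrite big_nil coef1 normr_nat expr0; case: (i == 0).
have {}IH k := IH k (fun y yrs => rsT y (mem_behead (s := z :: rs) yrs)).
have zT : `|z| <= T by rewrite rsT // inE eqxx.
rewrite big_cons mulrBl coefB coefXM coefCM exprS mulrDl mul1r.
apply: le_trans (ler_normB _ _) _; apply: lerD.
  by case: (i == 0); rewrite ?normr0 ?exprn_ge0 ?addr_ge0.
by rewrite normrM ler_pM.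
Qed.

Definition bounded_int_poly (d B : nat) : set {poly int} :=
  [set p | (size p <= d.+1)%N /\ forall i : nat, (absz (p`_i)%R <= B)%N]%classic.

Lemma finite_bounded_int_poly (d B : nat) : finite_set (bounded_int_poly d B).
Proof.
pose g (u : {ffun 'I_d.+1 -> 'I_(B.*2.+1)}) : {poly int} :=
  \poly_(i < d.+1) ((u (inord i) : nat)%:Z - B%:Z).
apply: (sub_finite_set (B := [set` map g (enum {: {ffun 'I_d.+1 -> 'I_(B.*2.+1)}})]%classic)).
  move=> p [p_sz pB] /=.
  apply/mapP; exists [ffun i : 'I_d.+1 => inord (absz (p`_i + B%:Z)%R)].
    by rewrite mem_enum.
  apply/polyP => i; rewrite coef_poly; case: ltnP => di; last first.
    by rewrite nth_default // (leq_trans p_sz).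
  have {pB} := pB i; rewrite ffunE (inordK di); move: (p`_i) => c cB.
  by rewrite inordK; lia.
exact: finite_seq.
Qed.

Lemma finite_roots (L : fieldType) (p : {poly L}) : p != 0 ->
  finite_set [set x | root p x]%classic.
Proof.
move=> p0; apply: contrapT => /(@infinite_set_fset _ _ (size p))[B Bp].
rewrite leqNgt => /negP; apply; apply: max_poly_roots => //.
  by apply/allP => x; exact: Bp.
exact: finmap.fset_uniq.
Qed.

Definition bounded_integers (L : fieldType) (d B : nat) : set L :=
  [set x | exists2 p, bounded_int_poly d B p & p \is monic /\ root (map_poly intr p) x]%classic.

Lemma finite_bounded_integers (L : fieldType) (d B : nat) :
  finite_set (@bounded_integers L d B).
Proof.
apply: (@sub_finite_set _ _ (\bigcup_(p in bounded_int_poly d B)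
    [set x : L | p \is monic /\ root (map_poly intr p) x])%classic).
  by move=> x [p pB px]; exists p.
apply: bigcup_finite; first exact: finite_bounded_int_poly.
move=> p _; have [p_mon|pn] := boolP (p \is monic).
  apply: sub_finite_set (@finite_roots L (map_poly intr p) _); first by move=> x [].
  by rewrite monic_neq0 // monic_map.
by apply: sub_finite_set (finite_set0 L) => x [].
Qed.

(** The coefficients of the minimal polynomial are integers, and elementary
    symmetric functions of real conjugates of absolute value at most T. *)
Lemma integral_house_le (R : realType) (K : fieldExtType rat) (x : K) (T : nat) :
    totally_real R K -> ring_of_integers x -> house_le x (T%:R : R) ->
  bounded_integers (\dim {:K}) (T.+1 ^ \dim {:K}) x.
Proof.
move=> K_real x_int xT; have [q [q_mon q_sz _ qmin]] := rat_minPoly x.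
have [rs rsE rsP] := real_splitting K_real q_mon qmin.
have [h h_mon hq] := integral_minPoly x_int q_mon qmin.
have dimx : (\dim <<1; x>> <= \dim {:K})%N by apply: dimvS; exact: subvf.
have hsz : size h = size q by rewrite -hq size_map_inj_poly //; exact: intr_inj.
have rs_sz : size rs = \dim <<1; x>>.
  have := congr1 (fun p : {poly R} => size p) rsE.
  by rewrite /= size_map_poly size_prod_XsubC q_sz => -[].
exists h; last first.
  by rewrite -map_poly_intr_alg hq qmin dvdpp.
split=> [|i]; first by rewrite hsz q_sz ltnS.
rewrite -(ler_nat R) natr_absz intr_norm.
have -> : (h`_i)%:~R = (\prod_(z <- rs) ('X - z%:P))`_i :> R.
  by rewrite -rsE coef_map -hq coef_map /= ratr_int.
apply: (@le_trans _ _ ((1 + T%:R) ^+ size rs)).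
  by apply: coef_prod_XsubC_le => // z /rsP[f <-]; exact: xT.
by rewrite rs_sz addrC natr1 natrX ler_weXn2l // ler1n.
Qed.

(** * Bilinear forms and lattices *)

Section BilinearForm.
Variables (K : fieldType) (V : vectType K) (B : {symmetric V}).

Lemma formC v w : B v w = B w v.
Proof. by rewrite hermC expr0 mul1r. Qed.

Lemma formDl u v w : B (u + v) w = B u w + B v w.
Proof. by rewrite linearDl. Qed.

Lemma formDr u v w : B u (v + w) = B u v + B u w.
Proof. by rewrite linearDr. Qed.

Lemma formZl a v w : B (a *: v) w = a * B v w.
Proof. by rewrite linearZl_LR. Qed.

Lemma formZr a v w : B v (a *: w) = a * B v w.
Proof. by rewrite formC formZl formC. Qed.

Lemma formNl v w : B (- v) w = - B v w.
Proof. by rewrite -scaleN1r formZl mulN1r. Qed.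

Lemma formNr v w : B v (- w) = - B v w.
Proof. by rewrite formC formNl formC. Qed.

Lemma formBl u v w : B (u - v) w = B u w - B v w.
Proof. by rewrite formDl formNl. Qed.

Lemma formBr u v w : B u (v - w) = B u v - B u w.
Proof. by rewrite formDr formNr. Qed.

Lemma orthogonal_notin_span (u : V) (s : seq V) :
  B u u != 0 -> (forall x, x \in s -> B u x = 0) -> u \notin <<s>>%VS.
Proof.
move=> u0 us; apply: contra u0 => us_span.
have uE := coord_span (us_span : u \in <<in_tuple s>>%VS).
rewrite {2}uE linear_sum /= big1 // => i _.
by rewrite formZr us ?mulr0 // mem_nth.
Qed.

Lemma orthogonal_ternary_eq0 (u1 u2 u3 r : V) : \dim {:V} = 3%N ->
    (forall v, v != 0 -> B v v != 0) ->
    B u1 u1 != 0 -> B u2 u2 != 0 -> B u3 u3 != 0 ->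
    B u2 u1 = 0 -> B u3 u1 = 0 -> B u3 u2 = 0 ->
    B r u1 = 0 -> B r u2 = 0 -> B r u3 = 0 ->
  r = 0.
Proof.
move=> V3 aniso q1 q2 q3 u21 u31 u32 r1 r2 r3.
apply/eqP; apply: contraT => /aniso r0.
have : free [:: r; u3; u2; u1].
  rewrite !free_cons nil_free andbT; apply/and4P; split;
    apply: orthogonal_notin_span => // x; rewrite !inE.
  - by case/or3P => /eqP ->.
  - by case/orP => /eqP ->.
  - by move/eqP ->.
rewrite /free => /eqP fr.
by have := dimvS (subvf <<[:: r; u3; u2; u1]>>); rewrite fr V3.
Qed.

End BilinearForm.

Section Lattice.
Variables (R : realType) (K : fieldExtType rat) (V : vectType K) (B : {symmetric V}).
Variable L : set V.
Hypothesis HL : is_lattice R B L.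

Lemma lattice_add v w : L v -> L w -> L (v + w).
Proof.
have [s ->] := lattice_finitely_generated HL.
move=> [a a_int ->] [b b_int ->]; exists (fun i => a i + b i).
  by move=> i; exact: integralD.
by rewrite -big_split; apply: eq_bigr => i _; rewrite scalerDl.
Qed.

Lemma twice_form_integral v w : L v -> L w -> ring_of_integers (2 * B v w).
Proof.
move=> Lv Lw.
have -> : 2 * B v w = B (v + w) (v + w) + - (B v v + B w w).
  by rewrite formDl !formDr (formC B w v); ring.
apply: integralD; first exact/(lattice_integral HL)/lattice_add.
by apply/integralN/integralD; exact: (lattice_integral HL).
Qed.

(** Total positivity of a value implies that it is nonzero only because a totally
    real field has a real embedding. *)
Lemma form_neq0 v : totally_real R K -> v != 0 -> B v v != 0.
Proof.
move=> K_real /(lattice_positive HL) Bv; apply/eqP => B0.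
have [k kgen] := primitive_generator K.
have [q [q_mon q_sz _ qmin]] := rat_minPoly k.
have [rs rsE rsP] := real_splitting K_real q_mon qmin.
have rs_sz : (0 < size rs)%N.
  have := congr1 (fun p : {poly R} => size p) rsE.
  by rewrite /= size_map_poly size_prod_XsubC q_sz kgen => -[<-]; exact: adim_gt0.
case: rs rsP rs_sz {rsE} => // z rs rsP _; have [|f _] := rsP z; first exact: mem_head.
by have := Bv f; rewrite B0 rmorph0 ltxx.
Qed.

Lemma form_ge0 v (f : {rmorphism K -> R}) : 0 <= f (B v v).
Proof.
have [->|v0] := eqVneq v 0; last exact/ltW/(lattice_positive HL).
by rewrite -(scale0r 0) formZl mul0r rmorph0.
Qed.

(** The norm of the component of v orthogonal to w is nonnegative at the place
    f. *)
Lemma Cauchy_Schwarz v w (f : {rmorphism K -> R}) :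
  f (B v w) ^+ 2 <= f (B v v) * f (B w w).
Proof.
have [->|w0] := eqVneq w 0.
  by rewrite -(scale0r 0) !formZr !mul0r rmorph0 expr0n mulr0.
have fw : 0 < f (B w w) by exact: (lattice_positive HL).
have Bw : B w w != 0 by rewrite -(fmorph_eq0 f) gt_eqF.
have := form_ge0 (v - (B v w / B w w) *: w) f.
have -> : B (v - (B v w / B w w) *: w) (v - (B v w / B w w) *: w)
    = B v v - B v w ^+ 2 / B w w.
  by rewrite formBl !formBr !formZl !formZr (formC B w v); field.
by rewrite rmorphB fmorph_div rmorphXn subr_ge0 ler_pdivrMr.
Qed.

Lemma twice_form_house_le v w (C1 C2 T : R) : 0 <= C1 -> 0 <= T ->
    house_le (B v v) C1 -> house_le (B w w) C2 -> 4 * (C1 * C2) <= T ^+ 2 ->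
  house_le (2 * B v w) T.
Proof.
move=> C10 T0 v1 w2 CT f.
rewrite -(ler_sqr (x := `|_|)) ?nnegrE // real_normK ?num_real //.
apply: le_trans CT; rewrite rmorphM rmorph_nat exprMn -natrX ler_pM2l ?ltr0n //.
apply: le_trans (Cauchy_Schwarz v w f) _.
apply: ler_pM; rewrite ?form_ge0 //.
  exact: le_trans (ler_norm _) (v1 f).
exact: le_trans (ler_norm _) (w2 f).
Qed.

End Lattice.

(** * Universal ternary lattices over extensions of a fixed field *)

Lemma seq_house_le (R : realType) (F : fieldExtType rat) (s : seq F) :
  totally_real R F -> exists T : nat, forall x, x \in s -> house_le x (T%:R : R).
Proof.
move=> F_real; elim: s => [|x s [T TP]]; first by exists 0%N.
have [N NP] := house_le_exists F_real x; exists (maxn T N) => y.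
rewrite inE => /predU1P[-> f|/TP yT f].
  by apply: le_trans (NP f) _; rewrite ler_nat leq_maxr.
by apply: le_trans (yT f) _; rewrite ler_nat leq_maxl.
Qed.

Lemma house_leW (R : realType) (K : fieldType) (x : K) (S T : R) :
  S <= T -> house_le x S -> house_le x T.
Proof. by move=> ST xS f; exact: le_trans (xS f) ST. Qed.

(** The elements D = c1 - (b/2)^2 are the discriminants of the planes spanned by
    vectors of norms 1 and c1.  As b is an integer of bounded house, they are
    finitely many, so the values c that they do not represent can be chosen of
    bounded house. *)
Lemma binary_test_set (R : realType) (F : fieldExtType rat) (c1 : F) (T : nat) :
    totally_real R F ->
  exists (cc : F -> F) (C : nat), forall b : F, ring_of_integers b ->
    house_le b (T%:R : R) -> totally_positive R (c1 - (b / 2) ^+ 2) ->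
    let c := cc b in
    [/\ ring_of_integers c, totally_positive R c, house_le c (C%:R : R)
      & forall x y, c != x ^+ 2 + (c1 - (b / 2) ^+ 2) * y ^+ 2].
Proof.
move=> F_real.
have /choice[cc ccP] : forall b : F, exists c : F,
    totally_positive R (c1 - (b / 2) ^+ 2) ->
    [/\ ring_of_integers c, totally_positive R c
      & forall x y, c != x ^+ 2 + (c1 - (b / 2) ^+ 2) * y ^+ 2].
  move=> b; have [D_pos|] := pselect (totally_positive R (c1 - (b / 2) ^+ 2)).
    by have [c cP] := binary_not_universal F_real D_pos; exists c.
  by move=> nD; exists 0.
have /finite_seqP[s sE] :=
  @finite_bounded_integers F (\dim {:F}) (T.+1 ^ \dim {:F}).
have [C CP] := seq_house_le (map cc s) F_real.
exists cc, C => b b_int bT D_pos; have [c_int c_pos cN] := ccP b D_pos.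
split=> //; apply: CP; apply: map_f.
have := integral_house_le F_real b_int bT.
by rewrite sE.
Qed.

Lemma shift_house_bound (R : realFieldType) (z k : R) : `|z| <= k ->
  0 < z + k + 1 /\ `|z + k + 1| <= 2 * k + 1.
Proof.
by rewrite !ler_norml => /andP[? ?]; split; [|apply/andP; split]; lra.
Qed.

(** Twice the scalar product of vectors of norms at most 2k+1 and C has house at
    most k-1, less than the least possible one outside F; any constant large
    enough would do for 100. *)
Lemma square_root_house_bound (R : realFieldType) (C k : R) :
    1 <= C -> 100 * C < k ->
  [/\ 0 <= 2 * k + 1, 0 <= k - 1 & 4 * ((2 * k + 1) * C) <= (k - 1) ^+ 2].
Proof. by move=> ? ?; split; nra. Qed.

(** Let the integers of K of house at most T be in F.  The vectors w1, w2 and w3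
    of norms 1, c1 and c have their scalar products in F, and are independent:
    c1 is not a square, and c is not represented by the plane spanned by w1 and
    w2.  If k is the least integer bound for the house of an integer of K
    outside F, then k > T and such an integer becomes totally positive, of house
    at most 2k+1, by adding k+1; a vector of that norm has its scalar products
    with w1, w2, w3 in F, which forces its norm into F. *)
Lemma universal_ternary_bound (R : realType) (F : fieldExtType rat) :
    totally_real R F ->
  exists T : nat, forall (K : fieldExtType rat) (j : {rmorphism F -> K}),
    totally_real R K -> has_universal_lattice R K 3 ->
    (forall x : K, ring_of_integers x -> house_le x (T%:R : R) ->
      exists y, x = j y) ->
  forall x : K, exists y, x = j y.
Proof.
move=> F_real.
have F1_pos : totally_positive R (1 : F) by move=> f; rewrite rmorph1.
have [c1 [c1_int c1_pos c1P]] := binary_not_universal F_real F1_pos.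
have [C1 c1C] := house_le_exists F_real c1.
have [cc [C2 ccP]] := binary_test_set c1 (2 * C1.+1) F_real.
pose C := (C1 + C2).+1; exists (100 * C)%N => K j K_real [V [B [L [V3 HL univ]]]] small.
have aniso := form_neq0 HL K_real.
have int1 : ring_of_integers (1 : K) by exact: (integral_intr K 1).
have house1 : house_le (1 : K) (1 : R) by move=> f; rewrite rmorph1 normr1.
have two0 : (2 : F) != 0 by rewrite -(ratr_nat F 2) -alg_num_field scaler_eq0 oner_eq0.
have jhalf (x : K) (b : F) : 2 * x = j b -> x = j (b / 2).
  have two0K : (2 : K) != 0 by rewrite -(rmorph_nat j) fmorph_eq0.
  by move=> xb; rewrite fmorph_div rmorph_nat -xb mulrC mulKf.
have [w1 Lw1 q1] : exists2 v, L v & B v v = 1.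
  by apply: univ => // f; rewrite rmorph1.
have [w2 Lw2 q2] : exists2 v, L v & B v v = j c1.
  by apply: univ; [exact: integral_ext | exact: totally_positive_ext].
have h2 := house_le_ext j c1C; rewrite -q2 in h2; rewrite -q1 in house1.
have C1_le : C1%:R <= C%:R :> R by rewrite ler_nat /C; lia.
have C2_le : C2%:R <= C%:R :> R by rewrite ler_nat /C; lia.
have one_le : 1 <= C%:R :> R by rewrite ler1n.
have C100 : (100 * C)%:R = 100 * C%:R :> R by rewrite natrM.
have b_house : house_le (2 * B w1 w2) ((2 * C1.+1)%:R : R).
  apply: (twice_form_house_le HL _ _ house1 h2) => //.
  by rewrite mul1r natrM -natr1; have : 0 <= C1%:R :> R := ler0n _ _; nra.
have b_int := twice_form_integral HL Lw1 Lw2.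
have [b bE] : exists b, 2 * B w1 w2 = j b.
  apply: small => //; apply: house_leW b_house; rewrite ler_nat /C; lia.
have w12 := jhalf _ _ bE; set beta := b / 2 in w12.
pose D := c1 - beta ^+ 2.
(* Gram-Schmidt orthogonalisation of w1, w2, w3, with coefficients in F. *)
pose u2 := w2 - j beta *: w1.
have u2w1 : B u2 w1 = 0 by rewrite formBl formZl q1 mulr1 formC w12 subrr.
have u2w2 : B u2 w2 = j D by rewrite formBl formZl q2 w12 -expr2 rmorphB rmorphXn.
have u2u2 : B u2 u2 = j D by rewrite {2}/u2 formBr formZr u2w1 mulr0 subr0.
have D0 : D != 0.
  by rewrite subr_eq0; have := c1P beta 0; rewrite expr0n mulr0 addr0.
have u20 : u2 != 0.
  by apply: contraNneq D0 => u20; rewrite -(fmorph_eq0 j) -u2u2 u20 -(scale0r 0) formZl mul0r.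
have D_pos : totally_positive R D.
  apply: (@totally_positive_subfield R F K j _ K_real).
  by rewrite -u2u2; exact: (lattice_positive HL).
have [||c_int c_pos cC cP] := ccP b _ _ D_pos.
- by apply: (@integral_subfield F K j); rewrite -bE.
- by apply: (@house_le_subfield R F K j _ _ K_real); rewrite -bE.
set c := cc b in c_int c_pos cC cP; rewrite -/beta -/D in cP.
have [w3 Lw3 q3] : exists2 v, L v & B v v = j c.
  by apply: univ; [exact: integral_ext | exact: totally_positive_ext].
have h3 := house_le_ext j cC; rewrite -q3 in h3.
have small2 v w : L v -> L w -> house_le (B v v) (C%:R : R) ->
    house_le (B w w) (C%:R : R) -> exists a, B v w = j a.
  move=> Lv Lw hv hw; have [|a aE] := small _ (twice_form_integral HL Lv Lw).
    apply: (twice_form_house_le HL _ _ hv hw); rewrite ?ler0n // C100; nra.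
  by exists (a / 2); exact: jhalf.
have H1 := house_leW one_le house1; have H2 := house_leW C1_le h2.
have H3 := house_leW C2_le h3.
have [x1 x1E] := small2 _ _ Lw3 Lw1 H3 H1.
have [x2 x2E] := small2 _ _ Lw3 Lw2 H3 H2.
pose e := x2 - beta * x1.
have w3u2 : B w3 u2 = j e.
  by rewrite formBr formZr x1E x2E -rmorphM -rmorphB.
pose u3 := w3 - j x1 *: w1 - j (e / D) *: u2.
have jD0 : j D != 0 by rewrite fmorph_eq0.
have w1u2 : B w1 u2 = 0 by rewrite formC.
have u3w1 : B u3 w1 = 0.
  by rewrite !formBl !formZl q1 x1E u2w1 mulr0 subr0 mulr1 subrr.
have u3u2 : B u3 u2 = 0.
  by rewrite !formBl !formZl w3u2 w1u2 u2u2 mulr0 subr0 fmorph_div divfK // subrr.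
pose G := c - x1 ^+ 2 - e ^+ 2 / D.
have u3u3 : B u3 u3 = j G.
  rewrite {2}/u3 !formBr !formZr u3w1 u3u2 !mulr0 !subr0 !formBl !formZl.
  rewrite q3 (formC _ w1) x1E (formC _ u2) w3u2.
  by rewrite -!rmorphM -!rmorphB; congr (j _); rewrite /G; ring.
have G0 : G != 0.
  apply: contraNneq (cP x1 (e / D)) => G0; apply/eqP.
  have -> : c = G + (x1 ^+ 2 + e ^+ 2 / D) by rewrite /G; ring.
  by rewrite G0; field.
have jG0 : j G != 0 by rewrite fmorph_eq0.
suff int_in (x : K) : ring_of_integers x -> exists y, x = j y.
  move=> x; have [a a0 ax] := integral_multiple x; have [y yE] := int_in _ ax.
  have a0K : a%:~R != 0 :> K by rewrite -(rmorph_int (in_alg K)) fmorph_eq0 intr_eq0.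
  by exists (y / a%:~R); rewrite fmorph_div rmorph_int -yE mulrC mulKf.
move=> x_int; apply: contrapT => xF.
pose outside (k : nat) := `[< exists h : K, [/\ ring_of_integers h,
  ~ (exists y, h = j y) & house_le h (k%:R : R)] >].
have ex_out : exists k, outside k.
  by have [k xk] := house_le_exists K_real x; exists k; apply/asboolP; exists x.
case: (ex_minnP ex_out) => k /asboolP[h [h_int hF hk]] kmin.
have k_small (y : K) : ring_of_integers y -> house_le y (k%:R - 1 : R) ->
    exists z, y = j z.
  move=> y_int yk; apply: contrapT => yF.
  have k_gt0 : (0 < k)%N.
    rewrite lt0n; apply/eqP => k0.
    apply: yF; apply: small => // f.
    by apply: le_trans (yk f) _; rewrite k0 sub0r (le_trans (lerN10 R)) ?ler0n.
  have : outside k.-1.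
    apply/asboolP; exists y; split=> // f.
    by have := yk f; rewrite -{1}(prednK k_gt0) -natr1 addrK.
  by move/kmin; rewrite leqNgt prednK // leqnn.
have k_big : 100 * C%:R < k%:R :> R.
  rewrite -C100 ltr_nat ltnNge; apply/negP => kC; apply: hF; apply: small => //.
  by apply: house_leW hk; rewrite ler_nat.
pose alpha := h + (k.+1)%:R.
have alphaE (f : {rmorphism K -> R}) : f alpha = f h + k%:R + 1 :> R.
  by rewrite /alpha rmorphD rmorph_nat -natr1 addrA.
have [v Lv qv] : exists2 v, L v & B v v = alpha.
  apply: univ.
    by apply: integralD => //; exact: (integral_intr K k.+1).
  by move=> f; rewrite alphaE; have [] := shift_house_bound (hk f).
have hv : house_le (B v v) (2 * k%:R + 1 : R).
  by move=> f; rewrite qv alphaE; have [] := shift_house_bound (hk f).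
have vw w : L w -> house_le (B w w) (C%:R : R) -> exists a, B v w = j a.
  move=> Lw hw; have [|a aE] := k_small _ (twice_form_integral HL Lv Lw).
    have [? ? ?] := square_root_house_bound one_le k_big.
    exact: (twice_form_house_le HL _ _ hv hw).
  by exists (a / 2); exact: jhalf.
have [a1 a1E] := vw _ Lw1 H1; have [a2 a2E] := vw _ Lw2 H2.
have [a3 a3E] := vw _ Lw3 H3.
pose b2 := a2 - beta * a1.
have vu2 : B v u2 = j b2.
  by rewrite formBr formZr a1E a2E -rmorphM -rmorphB.
pose b3 := a3 - x1 * a1 - e / D * b2.
have vu3 : B v u3 = j b3.
  by rewrite !formBr !formZr a1E a3E vu2 -!rmorphM -!rmorphB.
(* v equals its projection on the span of w1, u2, u3, which has coefficients
   in F. *)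
pose r := v - j a1 *: w1 - j (b2 / D) *: u2 - j (b3 / G) *: u3.
have r0 : r = 0.
  apply: (orthogonal_ternary_eq0 V3 aniso (u1 := w1) (u2 := u2) (u3 := u3)) => //.
  - by rewrite q1 oner_neq0.
  - by rewrite u2u2.
  - by rewrite u3u3.
  - by rewrite !formBl !formZl a1E q1 u2w1 u3w1 !mulr0 !subr0 mulr1 subrr.
  - rewrite !formBl !formZl vu2 w1u2 u2u2 u3u2 !mulr0 !subr0.
    by rewrite fmorph_div divfK // subrr.
  - rewrite !formBl !formZl vu3 u3u3 (formC _ w1) u3w1 (formC _ u2) u3u2 !mulr0 !subr0.
    by rewrite fmorph_div divfK // subrr.
apply: hF.
have vE : v = j a1 *: w1 + j (b2 / D) *: u2 + j (b3 / G) *: u3.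
  by apply/eqP; rewrite -subr_eq0 !opprD !addrA -/r r0.
exists (a1 ^+ 2 + b2 ^+ 2 / D + b3 ^+ 2 / G - (k.+1)%:R).
rewrite rmorphB rmorph_nat; apply/eqP; rewrite eq_sym subr_eq -/alpha -qv {2}vE.
rewrite !formDr !formZr a1E vu2 vu3 -!rmorphM -!rmorphD; apply/eqP; congr (j _).
by ring.
Qed.

(** * Finiteness *)

Lemma rmorph_factor (F K : fieldType) (L : fieldType) (f : {rmorphism F -> L})
    (k : {rmorphism K -> L}) :
  (forall x, exists y, f x = k y) -> exists j : {rmorphism F -> K}, forall x, k (j x) = f x.
Proof.
move=> /choice[j jP]; have jB : zmod_morphism j.
  by move=> x y; apply: (fmorph_inj k); rewrite -jP !rmorphB -!jP.
have jM : monoid_morphism j.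
  split=> [|x y]; apply: (fmorph_inj k); first by rewrite -jP !rmorph1.
  by rewrite -jP !rmorphM -!jP.
pose aM := GRing.isZmodMorphism.Build _ _ j jB.
pose mM := GRing.isMonoidMorphism.Build _ _ j jM.
by exists (HB.pack j aM mM : {rmorphism F -> K}) => x; rewrite /= -jP.
Qed.

Lemma dim_rmorph (F K : fieldExtType rat) (j : {rmorphism F -> K}) :
  (\dim {:F} <= \dim {:K})%N /\
  (\dim {:F} = \dim {:K} -> forall x : K, exists y, x = j y).
Proof.
have [k kgen] := primitive_generator F.
have [q [q_mon q_sz _ qmin]] := rat_minPoly k.
have [q' [q'_mon q'_sz _ q'min]] := rat_minPoly (j k).
have qq' : q = q'.
  apply/eqP; rewrite -eqp_monic // /eqp -qmin -(root_alg_subfield j) q'min dvdpp /=.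
  by rewrite -q'min root_alg_subfield qmin dvdpp.
have dimk : \dim <<1; j k>> = \dim {:F}.
  by apply: succn_inj; rewrite -q'_sz -qq' q_sz kgen.
split=> [|FK x]; first by rewrite -dimk dimvS ?subvf.
have jgen : <<1; j k>>%VS = fullv by apply/eqP; rewrite eqEdim subvf /= dimk FK.
have [p ->] := primitive_horner x jgen.
exists (map_poly (in_alg F) p).[k].
rewrite -horner_map -map_poly_comp; congr _.[_]; apply: eq_map_poly => a /=.
by rewrite !alg_num_field fmorph_rat.
Qed.

(** The field generated by a and e, for which a primitive element is a
    combination of a and e with integer coefficients. *)
Lemma compositum_exists (a e : algC) :
  exists (F : fieldExtType rat) (f : {rmorphism F -> algC}),
    [/\ exists x, f x = a, exists x, f x = e &
      forall (K : fieldExtType rat) (k : {rmorphism K -> algC}),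
        (exists x, k x = a) -> (exists x, k x = e) -> forall x, exists y, f x = k y].
Proof.
have [z [u zE] [ps psE]] := algC_PET [:: a; e].
have [F [f [[|z1 [|//]] // [z1E] Fgen]]] := num_field_exists [:: z].
rewrite adjoin_seq1 in Fgen.
have [p1 [p2 [aE eE]]] : exists p1 p2, a = (map_poly ratr p1).[z] /\ e = (map_poly ratr p2).[z].
  by case: ps psE => [|p1 [|p2 [|//]]] // [-> ->]; exists p1, p2.
exists F, f; split.
- by exists (map_poly (in_alg F) p1).[z1]; rewrite rmorph_horner_alg z1E.
- by exists (map_poly (in_alg F) p2).[z1]; rewrite rmorph_horner_alg z1E.
move=> K k [x1 x1E] [x2 x2E] x; have [p ->] := primitive_horner x Fgen.
pose zK := \sum_(i < 2) [:: x1; x2]`_i *+ u i.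
exists (map_poly (in_alg K) p).[zK].
rewrite !rmorph_horner_alg z1E; congr _.[_].
by rewrite zE /zK !big_ord_recl !big_ord0 !rmorphD !rmorphMn rmorph0 /= x1E x2E.
Qed.

Local Open Scope classical_set_scope.

(** Induction on a bound m for the codegree of F.  A field of the family that
    strictly contains F contains an integer outside F of house at most T, one of
    finitely many e, hence one of the finitely many fields F(e). *)
Lemma finite_universal_above (R : realType) (d m : nat) (F : fieldExtType rat)
    (f : {rmorphism F -> algC}) : (d <= \dim {:F} + m)%N ->
  finite_set [set S | totally_real_with_universal_lattice R d 3 S /\ range f `<=` S].
Proof.
elim: m F f => [|m IH] F f dm.
  apply: sub_finite_set (finite_set1 (range f)) => S [[K [k [-> Kd _ _]]] fk].
  have [|j jk] := @rmorph_factor F K algC f k.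
    by move=> x; have [|y _ <-] := fk (f x); [exists x | exists y].
  have [FK FKeq] := dim_rmorph j.
  have {}FKeq := FKeq (anti_leq (introT andP (conj FK _))).
  apply/seteqP; split=> // _ [x _ <-]; have [|y ->] := FKeq _ x.
    by rewrite Kd -(addn0 (\dim _)).
  by exists y => //; rewrite jk.
have [F_real|F_nreal] := pselect (totally_real R F); last first.
  apply: sub_finite_set (finite_set0 _) => S [[K [k [-> Kd K_real _]]] fk].
  have [|j jk] := @rmorph_factor F K algC f k.
    by move=> x; have [|y _ <-] := fk (f x); [exists x | exists y].
  exact: F_nreal (totally_real_subfield j K_real).
have [T TP] := universal_ternary_bound F_real.
have [t tgen] := primitive_generator F.
have /choice[G GP] : forall e : algC, exists G : {F' : fieldExtType rat & {rmorphism F' -> algC}},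
    [/\ exists x, projT2 G x = f t, exists x, projT2 G x = e &
      forall (K : fieldExtType rat) (k : {rmorphism K -> algC}),
        (exists x, k x = f t) -> (exists x, k x = e) ->
        forall x, exists y, projT2 G x = k y].
  move=> e; have [F' [f' f'P]] := compositum_exists (f t) e.
  by exists (existT _ F' f').
pose above e := [set S | totally_real_with_universal_lattice R d 3 S /\
  range (projT2 (G e)) `<=` S].
pose E := @bounded_integers algC d (T.+1 ^ d) `\` range f.
apply: (@sub_finite_set _ _ (range f |` \bigcup_(e in E) above e)).
  move=> S [SK fk]; have := SK => -[K [k [SE Kd K_real Kuniv]]]; rewrite SE in fk *.
  have [|j jk] := @rmorph_factor F K algC f k.
    by move=> x; have [|y _ <-] := fk (f x); [exists x | exists y].
  have [KF|nKF] := pselect (forall x : K, exists y, x = j y).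
    left; apply/seteqP; split=> // _ [x _ <-]; have [y ->] := KF x.
    by exists y => //; rewrite jk.
  right.
  have [x [x_int xT xF]] : exists x : K, [/\ ring_of_integers x,
      house_le x (T%:R : R) & ~ exists y, x = j y].
    apply: contrapT => nx; apply: nKF; apply: (TP K j K_real Kuniv) => x x_int xT.
    by apply: contrapT => xF; apply: nx; exists x.
  exists (k x).
    split; last by move=> [y _]; rewrite -jk => /fmorph_inj xy; apply: xF; exists y.
    have [p pB [p_mon px]] := integral_house_le K_real x_int xT.
    rewrite Kd in pB; exists p => //; split=> //.
    by rewrite -(eq_map_poly (rmorph_int k)) map_poly_comp fmorph_root.
  rewrite -SE; split=> // _ [y _ <-]; have [_ _ GK] := GP (k x).
  have [||z ->] := GK K k _ _ y.
  - by exists (j t); rewrite jk.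
  - by exists x.
  by rewrite SE; exists z.
rewrite finite_setU; split; first exact: finite_set1.
apply: bigcup_finite.
  by apply: sub_finite_set (@finite_bounded_integers algC d (T.+1 ^ d)) => e [].
move=> e [_ eF]; rewrite /above; case: (G e) (GP e) => F' f' /= [[t' t'E] [e' e'E] _].
apply: IH; rewrite addnS in dm; apply: leq_trans dm _; rewrite -addSn leq_add2r.
have [|j jf] := @rmorph_factor F F' algC f f'.
  move=> x; have [p ->] := primitive_horner x tgen.
  by exists (map_poly (in_alg F') p).[t']; rewrite !rmorph_horner_alg t'E.
have [FF' FF'eq] := dim_rmorph j; rewrite ltn_neqAle FF' andbT.
apply/eqP => /FF'eq/(_ e')[y yE]; apply: eF.
by exists y; rewrite // -jf -yE.
Qed.

Theorem theorem3 (R : realType) (d : nat) (hd : (0 < d)%N) :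
  finite_set (totally_real_with_universal_lattice R d 3).
Proof.
(* The compositum of 0 and 0 is the field of rational numbers. *)
have [Q [q [_ _ qP]]] := compositum_exists 0 0.
apply: sub_finite_set (@finite_universal_above R d d Q q (leq_addl _ _)) => S SK.
split=> // _ [x _ <-]; have [K [k [-> _ _ _]]] := SK.
have k0 : exists y, k y = 0 by exists 0; rewrite rmorph0.
by have [y ->] := qP K k k0 k0 x; exists y.
Qed.
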